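(* For a locally compact Polish group $G$ the following conditions are equivalent: (i) every left invariant pseudometric on $G$ (possibly having nothing in common with the topology of $G$) is right invariant; (ii) every left invariant metric in $\operatorname{Metr}_c(G)$ is right invariant; (iii) $G$ is either Abelian or iso-singular. In particular, up to isomorphism, there are only countably many (locally compact Polish) non-Abelian groups $G$ which satisfy (i).
   Context: A topological group is Polish if it is separable and completely metrizable. A metric is proper if all closed balls with respect to it are compact. $\operatorname{Metr}_c(G)$ is the set of all proper metrics on $G$ inducing the topology of $G$. Isomorphisms of topological groups are group isomorphisms that are homeomorphisms. A group $H$ is Boolean if $x^2 = e_H$ for all $x \in H$, where $e_H$ is the neutral element. A base pair is a pair $(H,p)$ where $H$ is a topological Abelian group and $p \in H$ satisfies $p^2 = e_H \neq p$. For a base pair $(H,p)$, $H \times_p \{-1,1\}$ denotes the topological group with underlying space $H \times \{-1,1\}$ (product topology, $\{-1,1\}$ discrete) and multiplication $(x,j)\cdot(y,k) = (xy,jk)$ if $j=1$; $(xy^{-1},jk)$ if $j=-1$, $k=1$; $(xy^{-1}p,jk)$ if $j=k=-1$. A topological group is iso-singular if it is isomorphic to $(H \times_p \{-1,1\}) \times_{\tilde{p}} \{-1,1\}$ for some base pair $(H,p)$ with $H$ Boolean, where $\tilde{p} = (p,1)$ (in this case $H \times_p \{-1,1\}$ is Abelian and $(H \times_p \{-1,1\},\tilde p)$ is again a base pair). *)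

(* Defs.v *)
From HB Require Import structures.
From mathcomp Require Import all_boot all_order all_algebra.
From mathcomp Require Import all_classical all_reals.
From mathcomp Require Import topology.

Set Implicit Arguments.
Unset Strict Implicit.
Unset Printing Implicit Defensive.

Import Order.TTheory GRing.Theory Num.Theory.

Local Open Scope classical_set_scope.
Local Open Scope ring_scope.

HB.mixin Record isTopologicalGroup G & Topological G & Group G := {
  mulg_continuous : continuous (fun x : G * G => x.1 * x.2)%g ;
  invg_continuous : continuous (fun x : G => x^-1)%g
}.

(* No separation axiom is included; [polish] below implies Hausdorff. *)
#[short(type="topologicalGroupType")]
HB.structure Definition TopologicalGroup :=
  {G of Topological G & Group G & isTopologicalGroup G}.

Definition abelian_group (G : groupType) := forall x y : G, (x * y = y * x)%g.

Definition boolean_group (G : groupType) := forall x : G, (x ^+ 2 = 1)%g.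

Definition topgroup_isomorphic (G H : topologicalGroupType) :=
  exists (f : G -> H) (g : H -> G),
    [/\ {morph f : x y / (x * y)%g}, cancel f g, cancel g f,
        continuous f & continuous g].

Section Metrics.
Context {R : realType}.

Record is_pseudometric (T : Type) (d : T -> T -> R) : Prop := IsPseudometric {
  pseudometric_ge0 : forall x y, 0 <= d x y ;
  pseudometric_refl : forall x, d x x = 0 ;
  pseudometric_sym : forall x y, d x y = d y x ;
  pseudometric_triangle : forall x y z, d x z <= d x y + d y z }.

Definition is_metric (T : Type) (d : T -> T -> R) :=
  is_pseudometric d /\ forall x y, d x y = 0 -> x = y.

Definition induces_topology (T : topologicalType) (d : T -> T -> R) :=
  forall x : T,
    nbhs x = filter_from [set e | 0 < e] (fun e => [set y | d x y < e]).

Definition cauchy_seq (T : Type) (d : T -> T -> R) (u : nat -> T) :=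
  forall e, 0 < e ->
    exists N, forall m n, (N <= m)%N -> (N <= n)%N -> d (u m) (u n) < e.

(* Convergence is in the topology of T; it is convergence for d when d
   induces that topology. *)
Definition complete_metric (T : topologicalType) (d : T -> T -> R) :=
  forall u : nat -> T, cauchy_seq d u -> exists l : T, u @ \oo --> l.

Definition proper_metric (T : topologicalType) (d : T -> T -> R) :=
  forall (x : T) (r : R), compact [set y | d x y <= r].

Definition Metr_c (T : topologicalType) : set (T -> T -> R) :=
  [set d | [/\ is_metric d, induces_topology d & proper_metric d]].

Definition left_invariant (G : groupType) (d : G -> G -> R) :=
  forall g x y : G, d (g * x)%g (g * y)%g = d x y.

Definition right_invariant (G : groupType) (d : G -> G -> R) :=
  forall g x y : G, d (x * g)%g (y * g)%g = d x y.

End Metrics.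

Arguments Metr_c R T : clear implicits.

Definition separable (T : topologicalType) :=
  exists2 D : set T, countable D & dense D.

Definition completely_metrizable (R : realType) (T : topologicalType) :=
  exists d : T -> T -> R,
    [/\ is_metric d, induces_topology d & complete_metric d].

Definition polish (R : realType) (T : topologicalType) :=
  separable T /\ completely_metrizable R T.

Record basePair := BasePair {
  base_group :> topologicalGroupType ;
  base_abelian : abelian_group base_group ;
  base_point : base_group ;
  base_point_sq : (base_point ^+ 2 = 1)%g ;
  base_point_neq1 : base_point <> 1%g }.

(* The boolean b stands for the sign (-1)^b, so that [addb] is the product of
   signs; [bool] carries the discrete topology. *)
Definition twist (B : basePair) : Type := (base_group B * bool)%type.

HB.instance Definition _ (B : basePair) :=
  Topological.copy (twist B) (base_group B * bool)%type.

Section Twist.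
Variable B : basePair.
Local Open Scope group_scope.
Local Notation p := (base_point B).

Definition twist_mul (u v : twist B) : twist B :=
  match u, v with
  | (x, false), (y, k) => (x * y, k)
  | (x, true), (y, false) => (x * y^-1, true)
  | (x, true), (y, true) => (x * y^-1 * p, false)
  end.

Definition twist_one : twist B := (1, false).

Definition twist_inv (u : twist B) : twist B :=
  if u.2 then (u.1 * p, true) else (u.1^-1, false).

Let mulC (x y : B) : x * y = y * x. Proof. exact: base_abelian. Qed.
Let mulCA (x y z : B) : x * (y * z) = y * (x * z).
Proof. by rewrite !mulgA (mulC x). Qed.
Let pp : p * p = 1. Proof. exact: base_point_sq. Qed.
Let pV : p^-1 = p. Proof. by rewrite -[LHS]mulg1 -pp mulKg. Qed.
Let pK (x : B) : p * (p * x) = x. Proof. by rewrite mulgA pp mul1g. Qed.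

Lemma twist_mulA : associative twist_mul.
Proof.
move=> [x []] [y []] [z []] //=; congr pair;
  rewrite ?(invgM, invgK, pV) -?mulgA //; congr (x * _).
- by rewrite (mulC z) mulCA.
- by rewrite mulCA (mulC z).
- by rewrite mulCA.
- by rewrite mulC.
Qed.

Lemma twist_mul1 : left_id twist_one twist_mul.
Proof. by move=> [x j] /=; rewrite mul1g. Qed.

Lemma twist_mulr1 : right_id twist_one twist_mul.
Proof. by move=> [x []] /=; rewrite ?invg1 mulg1. Qed.

Lemma twist_mulV : left_inverse twist_one twist_inv twist_mul.
Proof.
move=> [x []]; rewrite /twist_inv /twist_one /= ?mulVg //; congr pair.
by rewrite (mulC x) mulgK pp.
Qed.

Lemma twist_mulrV : right_inverse twist_one twist_inv twist_mul.
Proof.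
move=> [x []]; rewrite /twist_inv /twist_one /= ?mulgV //; congr pair.
by rewrite invgM pV mulCA mulgV mulg1 pp.
Qed.

HB.instance Definition _ := isGroup.Build (twist B)
  twist_mulA twist_mul1 twist_mulr1 twist_mulV twist_mulrV.

Lemma twistE (u v : twist B) : u * v = twist_mul u v.
Proof. by []. Qed.

Let fst_continuous : continuous (fun u : twist B => u.1).
Proof. by move=> [x j]; exact: cvg_fst. Qed.

Let snd_continuous : continuous (fun u : twist B => u.2).
Proof. by move=> [x j]; exact: cvg_snd. Qed.

Let nbhs_sign (T : topologicalType) (f : T -> twist B) (t : T) :
  {for t, continuous f} -> \forall s \near t, (f s).2 = (f t).2.
Proof.
move=> cf; have : (f s).2 @[s --> t] --> (f t).2.
  apply: (@continuous_comp _ _ _ f (fun u : twist B => u.2)) => //.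
  exact: snd_continuous.
by move=> /(_ [set b | b = (f t).2]); apply; exact/principal_filterP.
Qed.

Let cvgMg (T : topologicalType) (f g : T -> B) (t : T) :
  {for t, continuous f} -> {for t, continuous g} ->
  {for t, continuous (fun s => f s * g s)}.
Proof.
move=> cf cg.
apply: (@continuous_comp _ _ _ (fun s => (f s, g s)) (fun x => x.1 * x.2)).
  exact: cvg_pair.
exact: mulg_continuous.
Qed.

Let cvgVg (T : topologicalType) (f : T -> B) (t : T) :
  {for t, continuous f} -> {for t, continuous (fun s => (f s)^-1)}.
Proof.
move=> cf; apply: (@continuous_comp _ _ _ f (fun x => x^-1)) => //.
exact: invg_continuous.
Qed.

Let cvg_sign (T : topologicalType) (f : T -> B) (k : bool) (t : T) :
  {for t, continuous f} -> {for t, continuous (fun s => (f s, k) : twist B)}.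
Proof. by move=> cf; exact: cvg_pair cf (cvg_cst k). Qed.

Lemma twist_mul_continuous :
  continuous (fun u : twist B * twist B => u.1 * u.2).
Proof.
move=> w.
have c1 : {for w, continuous (fun u : twist B * twist B => u.1)}.
  exact: cvg_fst.
have c2 : {for w, continuous (fun u : twist B * twist B => u.2)}.
  exact: cvg_snd.
have c11 : {for w, continuous (fun u : twist B * twist B => u.1.1)}.
  apply: (@continuous_comp _ _ _ _ (fun u : twist B => u.1)) => //.
  exact: fst_continuous.
have c21 : {for w, continuous (fun u : twist B * twist B => u.2.1)}.
  apply: (@continuous_comp _ _ _ _ (fun u : twist B => u.1)) => //.
  exact: fst_continuous.
pose h (u : twist B * twist B) : twist B :=
  twist_mul (u.1.1, w.1.2) (u.2.1, w.2.2).
have hE : \forall u \near w, h u = u.1 * u.2.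
  have := nbhs_sign c1; have := nbhs_sign c2; apply: filterS2.
  by rewrite /h => -[[x j] [y k]] /= <- <-; rewrite twistE.
have hw : h w = w.1 * w.2 by move: (hE) => /nbhs_singleton.
have ch : {for w, continuous h}.
  rewrite /h; case: (w.1.2) => /=; last by apply: cvg_sign; exact: cvgMg.
  case: (w.2.2) => /=; apply: cvg_sign; last by apply: cvgMg => //; exact: cvgVg.
  by apply: cvgMg; [apply: cvgMg => //; exact: cvgVg|exact: cvg_cst].
by rewrite /continuous_at -hw; apply: cvg_trans (near_eq_cvg hE) ch.
Qed.

Lemma twist_inv_continuous : continuous (fun u : twist B => u^-1).
Proof.
move=> w.
have c0 : {for w, continuous (fun u : twist B => u)} by exact: cvg_id.
have c1 : {for w, continuous (fun u : twist B => u.1)}.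
  exact: fst_continuous.
pose h (u : twist B) : twist B := twist_inv (u.1, w.2).
have hE : \forall u \near w, h u = u^-1.
  by have := nbhs_sign c0; rewrite /h; apply: filterS => -[x j] /= <-.
have hw : h w = w^-1 by move: (hE) => /nbhs_singleton.
have ch : {for w, continuous h}.
  rewrite /h /twist_inv; case: (w.2) => /=; apply: cvg_sign.
    by apply: cvgMg => //; exact: cvg_cst.
  exact: cvgVg.
by rewrite /continuous_at -hw; apply: cvg_trans (near_eq_cvg hE) ch.
Qed.

HB.instance Definition _ := isTopologicalGroup.Build (twist B)
  twist_mul_continuous twist_inv_continuous.

Hypothesis bool_B : boolean_group B.

Let invB (x : B) : x^-1 = x.
Proof. by rewrite -[LHS]mulg1 -(bool_B x) expg2 mulKg. Qed.

Lemma twist_abelian : abelian_group (twist B).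
Proof.
by move=> [x []] [y []]; rewrite !twistE /= ?invB (mulC x).
Qed.

Definition twist_point : twist B := (p, false).

Lemma twist_point_sq : twist_point ^+ 2 = 1.
Proof. by rewrite expg2 twistE /= pp. Qed.

Lemma twist_point_neq1 : twist_point <> 1.
Proof. by move=> [] /base_point_neq1. Qed.

Definition twist_basePair : basePair :=
  BasePair twist_abelian twist_point_sq twist_point_neq1.

End Twist.

Definition iso_singular (G : topologicalGroupType) :=
  exists (B : basePair) (bool_B : boolean_group B),
    topgroup_isomorphic G (twist (twist_basePair bool_B)).

(* Main.v *)
(* A left invariant pseudometric d is determined by its length function
   N x = d(1, x), and it is right invariant iff N is constant on conjugacy
   classes; since N x = N x^-1, this is automatic as soon as every conjugate of
   x is x or x^-1.  Conversely, if x' = g^-1 x g is neither x nor x^-1, let f be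
   a narrow bump at 1 minus a narrow bump at x: adding
   sup_h |f(h y) - f(h z)| to a left invariant proper metric d(y, z) gives
   another one, and the two metrics cannot both give x and x' the same length.
   A left invariant proper metric exists (Struble): a bump function yields a
   left invariant metric, and a Lipschitz smoothing of the index in an
   exhaustion D_n by compact sets with D_n D_n included in D_(n+1) makes it
   proper.  In a non-Abelian group where every conjugate of x is x or x^-1,
   non-commuting a, b generate a quaternion group, and their centralizer H is
   open and Boolean, so that G = H + Ha + Hb + Hab is iso-singular.

   For the countability statement, a locally compact Boolean group with a
   countable dense subset has a compact open subgroup and arbitrarily small open
   subgroups; hence its continuous characters separate points, and it is
   isomorphic to (Z/2)^S x (Z/2)^(T), the second factor being a discrete direct
   sum, with S and T countable.  One coordinate can be chosen to detect p, so
   the group is determined by the cardinals of S and T. *)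

Require Import Defs.
From HB Require Import structures.
From mathcomp Require Import all_boot all_order all_algebra.
From mathcomp Require Import all_classical all_reals.
From mathcomp Require Import topology.
From mathcomp Require Import ring lra.

Set Implicit Arguments.
Unset Strict Implicit.
Unset Printing Implicit Defensive.

Import Order.TTheory GRing.Theory Num.Theory.

Local Open Scope classical_set_scope.
Local Open Scope ring_scope.

(** * Averages over finite Boolean groups *)

Section FiniteAverages.
Variables (R : realFieldType) (G : groupType).
Hypotheses (mulC : abelian_group G) (sqG : boolean_group G).

(** All products of sublists of [l], with multiplicity: relations among the generators create
    repetitions. They are harmless, since sums over the list rely on its invariance under
    translation. *)
Fixpoint span (l : seq G) : seq G :=
  if l is g :: l' then span l' ++ [seq (g * x)%g | x <- span l'] else [:: 1%g].

Definition stab (s : seq G) (g : G) := perm_eq [seq (g * x)%g | x <- s] s.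

Definition prodg (l : seq G) : G := foldr (fun x y => (x * y)%g) 1%g l.

Lemma boolean_mulgg (x : G) : (x * x = 1)%g.
Proof. by rewrite -expg2 sqG. Qed.

Lemma boolean_invg (x : G) : (x^-1 = x)%g.
Proof. by rewrite -[LHS]mulg1 -(boolean_mulgg x) mulKg. Qed.

Lemma stab1 s : stab s 1%g.
Proof.
by rewrite /stab (eq_map (g := id)) ?map_id ?perm_refl // => x; rewrite mul1g.
Qed.

Lemma stabM s x y : stab s x -> stab s y -> stab s (x * y)%g.
Proof.
rewrite /stab => sx sy.
rewrite (eq_map (g := (fun z => x * z)%g \o (fun z => y * z)%g)); last first.
  by move=> z /=; rewrite mulgA.
by rewrite map_comp; apply: perm_trans sx; exact: perm_map.
Qed.

(** The head generator is an involution, so translation by it swaps the two halves of the list; the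
    other generators permute each half. *)
Lemma stab_span l : {in l, forall g, stab (span l) g}.
Proof.
elim: l => // h l IH g; rewrite /stab /= map_cat -!map_comp inE.
case/predU1P => [->|/IH sg].
  rewrite perm_catC perm_cat // -[X in perm_eq _ X]map_id.
  rewrite (@eq_map _ _ _ id) // => x /=.
  by rewrite mulgA boolean_mulgg mul1g.
rewrite perm_cat //.
rewrite (eq_map (g := (fun z => h * z)%g \o (fun z => g * z)%g)); last first.
  by move=> z /=; rewrite !mulgA (mulC g).
by rewrite map_comp; exact: perm_map.
Qed.

Lemma mem_span_stab s l :
  {in l, forall x, stab s x} -> {in span l, forall x, stab s x}.
Proof.
elim: l => [_ x|g l IH sl x] /=; first by rewrite inE => /eqP ->; exact: stab1.
have {}IH : {in span l, forall x, stab s x}.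
  by apply: IH => y yl; apply: sl; rewrite inE yl orbT.
rewrite mem_cat => /orP[/IH //|/mapP[y /IH sy ->]].
by apply: stabM => //; apply: sl; rewrite mem_head.
Qed.

Lemma span1 l : 1%g \in span l.
Proof. by elim: l => [|g l IH] /=; rewrite ?inE // mem_cat IH. Qed.

Lemma span_closed (P : G -> Prop) l : P 1%g ->
  (forall x y, P x -> P y -> P (x * y)%g) ->
  {in l, forall x, P x} -> {in span l, forall x, P x}.
Proof.
move=> P1 PM; elim: l => [_ x|g l IH sl x] /=; first by rewrite inE => /eqP ->.
have {}IH : {in span l, forall x, P x}.
  by apply: IH => y yl; apply: sl; rewrite inE yl orbT.
rewrite mem_cat => /orP[/IH //|/mapP[y /IH sy ->]].
by apply: PM => //; apply: sl; rewrite mem_head.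
Qed.

Lemma spanM l x y : x \in span l -> y \in span l -> (x * y)%g \in span l.
Proof.
move=> xl yl; have := mem_span_stab (@stab_span l) xl.
by move=> /perm_mem/(_ (x * y)%g) <-; exact: map_f.
Qed.

Lemma mem_span l x : x \in l -> x \in span l.
Proof.
elim: l => // h l IH; rewrite inE /= mem_cat => /predU1P[->|/IH -> //].
by apply/orP; right; apply/mapP; exists 1%g; rewrite ?span1 ?mulg1.
Qed.

Lemma sum_shift s y (F : G -> R) : stab s y ->
  \sum_(x <- s) F (x * y)%g = \sum_(x <- s) F x.
Proof.
move=> sy; rewrite -[RHS](perm_big _ sy) big_map.
by apply: eq_bigr => x _; rewrite mulC.
Qed.

(** Cauchy-Schwarz against the constant 1. [crossS] adds up the squares [(t - a y) ^+ 2], and its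
    instance at the new entry bounds the mixed term of the induction. *)
Lemma sqr_sum_le (s : seq G) (a : G -> R) :
  (\sum_(x <- s) a x) ^+ 2 <= (size s)%:R * \sum_(x <- s) a x ^+ 2.
Proof.
have cross t : 2 * t * (\sum_(x <- s) a x) <=
    (size s)%:R * t ^+ 2 + \sum_(x <- s) a x ^+ 2.
  elim: s => [|x s IH] /=; first by rewrite !big_nil; lra.
  rewrite !big_cons -natr1; have := sqr_ge0 (t - a x); nra.
elim: s cross => [|x s IH] cross /=; first by rewrite !big_nil; lra.
rewrite !big_cons -natr1.
have crossS t : 2 * t * (\sum_(x <- s) a x) <=
    (size s)%:R * t ^+ 2 + \sum_(x <- s) a x ^+ 2.
  elim: s {IH cross} => [|y s IH] /=; first by rewrite !big_nil; lra.
  rewrite !big_cons -natr1; have := sqr_ge0 (t - a y); nra.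
have := IH crossS; have := crossS (a x); nra.
Qed.

Definition conv s (theta f : G -> R) (x : G) := \sum_(g <- s) theta (g * x)%g * f g.

(* Splitting f into its even and odd parts under translation by one factor y
   of the product turns the defect of invariance of conv f into orthogonal
   pieces; only the odd part contributes, and convolution with the slowly
   varying theta almost annihilates it. *)
Lemma conv_defect_le s (theta : G -> R) c ys :
  {in ys, forall y, stab s y /\
    forall x, `|theta (x * y)%g - theta x| <= c} ->
  forall f, \sum_(x <- s) conv s theta f x *
      (conv s theta f x - conv s theta f (x * prodg ys)%g) <=
    c ^+ 2 / 2 * (size s)%:R ^+ 2 * \sum_(x <- s) f x ^+ 2.
Proof.
elim: ys => [_ f|y ys IH yP f] /=.
  rewrite big1 => [|x _]; last by rewrite mulg1 subrr mulr0.
  apply: mulr_ge0; last by apply: sumr_ge0 => x _; rewrite sqr_ge0.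
  by rewrite mulr_ge0 ?divr_ge0 ?sqr_ge0.
have [sy cy] : stab s y /\ forall x, `|theta (x * y)%g - theta x| <= c.
  by apply: yP; rewrite mem_head.
have {}IH := IH (fun z zys => yP z (mem_behead (s := y :: ys) zys)).
set z := prodg ys in IH *; set u := conv s theta f.
have c0 : 0 <= c by apply: le_trans (cy 1%g).
pose fp x := (f x + f (x * y)%g) / 2.
pose fm x := (f x - f (x * y)%g) / 2.
have fmy x : fm (x * y)%g = - fm x.
  by rewrite /fm -mulgA boolean_mulgg mulg1 -mulNr opprB.
pose P := conv s theta fp; pose M := conv s theta fm.
have uy x : conv s theta (fun g => f (g * y)%g) x = u (x * y)%g.
  rewrite /u /conv -[RHS](sum_shift _ sy); apply: eq_bigr => g _.
  by rewrite (mulC x) mulgA -(mulgA g) boolean_mulgg mulg1.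
have PE x : P x = (u x + u (x * y)%g) / 2.
  rewrite -uy /P /u /conv -big_split /= mulr_suml; apply: eq_bigr => g _.
  by rewrite /fp; field.
have ME x : M x = (u x - u (x * y)%g) / 2.
  rewrite -uy /M /u /conv -sumrB mulr_suml; apply: eq_bigr => g _.
  by rewrite /fm; field.
have uE x : u x = P x + M x by rewrite PE ME; field.
have Py x : P (x * y)%g = P x.
  by rewrite !PE -mulgA boolean_mulgg mulg1 addrC.
have My x : M (x * y)%g = - M x.
  by rewrite !ME -mulgA boolean_mulgg mulg1 -mulNr opprB.
(* Averaging the sum for [M x] with its shift by [y] pairs the odd function [fm] with differences of
   [theta], each at most [c]. *)
have Msmall x : `|M x| <= c / 2 * \sum_(g <- s) `|fm g|.
  have -> : M x = \sum_(g <- s) (theta (g * x)%g - theta (g * x * y)%g) / 2 * fm g.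
    have : M x = - \sum_(g <- s) theta (g * x * y)%g * fm g.
      rewrite /M /conv -sumrN -[LHS](sum_shift _ sy); apply: eq_bigr => g _.
      by rewrite fmy -!mulgA (mulC y) mulrN.
    move=> eM; rewrite (eq_bigr (fun g =>
      (theta (g * x)%g * fm g - theta (g * x * y)%g * fm g) / 2)); last first.
      by move=> g _; field.
    rewrite -mulr_suml sumrB -[X in _ - X]opprK -eM -/(conv s theta fm x) -/(M x).
    by field.
  rewrite mulr_sumr; apply: le_trans (ler_norm_sum _ _ _) _.
  apply: ler_sum => g _; rewrite normrM; apply: ler_wpM2r => //.
  rewrite normrM distrC (ger0_norm (x := 2^-1)) ?invr_ge0 //.
  by apply: ler_wpM2r; rewrite ?invr_ge0.
have Msum : \sum_(x <- s) M x * (M x + M (x * z)%g) <=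
    c ^+ 2 / 2 * (size s)%:R ^+ 2 * \sum_(x <- s) fm x ^+ 2.
  move: Msmall; have := sqr_sum_le s (fun g => `|fm g|).
  under [X in _ * X]eq_bigr do rewrite real_normK ?num_real//.
  set A := \sum_(g <- s) `|fm g| => leA Msmall.
  have A0 : 0 <= A by apply: sumr_ge0 => g _.
  apply: (@le_trans _ _ (\sum_(x <- s) c ^+ 2 / 2 * A ^+ 2)).
    apply: ler_sum => x _; have := Msmall x; have := Msmall (x * z)%g.
    rewrite !ler_norml => /andP[h1 h2] /andP[h3 h4].
    have : 0 <= c / 2 * A by rewrite !mulr_ge0 ?invr_ge0.
    set t := c / 2 * A in h1 h2 h3 h4 *.
    have -> : c ^+ 2 / 2 * A ^+ 2 = 2 * t ^+ 2 by rewrite /t; field.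
    nra.
  rewrite big_const_seq count_predT iter_addr addr0 -[leLHS]mulr_natr.
  have : c ^+ 2 / 2 * A ^+ 2 <= c ^+ 2 / 2 * ((size s)%:R * \sum_(x <- s) fm x ^+ 2).
    by apply: ler_wpM2l => //; rewrite mulr_ge0 ?invr_ge0 ?sqr_ge0.
  move=> /(ler_wpM2r (ler0n R (size s))) h. apply: (le_trans h).
  lra.
(* The mixed terms change sign when [x] becomes [x * y], because [P] is invariant and [M] is odd. *)
have cross : \sum_(x <- s) (P x * (M x + M (x * z)%g) +
    M x * (P x - P (x * z)%g)) = 0.
  set S := LHS; suff : S = - S by lra.
  rewrite {1}/S -[LHS](sum_shift _ sy) /S -sumrN; apply: eq_bigr => x _.
  rewrite -!mulgA (mulC y z) !mulgA !Py !My; ring.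
(* Orthogonality: the square norm splits exactly, so the constant does not grow with the length of
   [ys]. *)
have fE : \sum_(x <- s) f x ^+ 2 =
    \sum_(x <- s) fp x ^+ 2 + \sum_(x <- s) fm x ^+ 2.
  have e : \sum_(x <- s) f (x * y)%g ^+ 2 = \sum_(x <- s) f x ^+ 2.
    exact: (sum_shift (fun x => f x ^+ 2) sy).
  rewrite -big_split [RHS](eq_bigr (fun x => f x ^+ 2 / 2 + f (x * y)%g ^+ 2 / 2)).
    by rewrite big_split /= -!mulr_suml e; field.
  by move=> x _; rewrite /= /fp /fm; field.
rewrite fE mulrDr; apply: le_trans _ (lerD (IH fp) Msum).
rewrite (eq_bigr (fun x => (P x * (P x - P (x * z)%g) +
    M x * (M x + M (x * z)%g)) + (P x * (M x + M (x * z)%g) +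
    M x * (P x - P (x * z)%g)))) => [|x _].
  by rewrite big_split /= cross addr0 big_split.
have Pyz : P (x * y * z)%g = P (x * z)%g.
  by rewrite -mulgA (mulC y) mulgA Py.
have Myz : M (x * y * z)%g = - M (x * z)%g.
  by rewrite -mulgA (mulC y) mulgA My.
by rewrite mulgA !uE Pyz Myz; ring.
Qed.

End FiniteAverages.

(** * Boolean topological groups *)

Section TopologicalGroups.
Variable G : topologicalGroupType.
Implicit Types (a b x y : G) (A B C U : set G).

Lemma nbhs_mulg a b U : nbhs (a * b)%g U ->
  exists A B, [/\ nbhs a A, nbhs b B &
    forall x y, A x -> B y -> U (x * y)%g].
Proof.
move=> /(@mulg_continuous G (a, b))[[A B] /= [Aa Bb] AB].
by exists A, B; split=> // x y Ax By; exact: (AB (x, y)).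
Qed.

Lemma mulg_continuous_left a : continuous (fun x : G => (a * x)%g).
Proof.
move=> x U /nbhs_mulg[A [B [Aa Bx AB]]].
by apply: filterS Bx => y By; apply: AB => //; exact: nbhs_singleton.
Qed.

Lemma mulg_continuous_right a : continuous (fun x : G => (x * a)%g).
Proof.
move=> x U /nbhs_mulg[A [B [Ax Ba AB]]].
by apply: filterS Ax => y Ay; apply: AB => //; exact: nbhs_singleton.
Qed.

Lemma nbhs_translate a U : nbhs a U <-> nbhs 1%g [set x | U (a * x)%g].
Proof.
split=> [aU|U1].
  by have := @mulg_continuous_left a 1%g U; rewrite mulg1; apply.
have : nbhs a [set x | U (a * (a^-1 * x))%g].
  apply: (@mulg_continuous_left a^-1%g a [set x | U (a * x)%g]).
  by rewrite mulVg.
apply: filterS => x /=.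
by rewrite mulgA mulgV mul1g.
Qed.

Lemma compact_translates C U : compact C -> nbhs 1%g U ->
  exists2 ks : seq G, {in ks, forall k, C k} &
    forall x, C x -> exists2 k, k \in ks & U (k^-1 * x)%g.
Proof.
move=> /compact_near_coveringP cC U1.
(* What holds near this filter holds for some finite list; this turns near covering into a finite
   subcover. *)
pose F := filter_from [set: seq G] (fun l => [set l' : seq G | {subset l <= l'}]).
have FF : Filter F.
  apply: filter_from_filter; first by exists [::].
  move=> l1 l2 _ _; exists (l1 ++ l2) => // l /= ll.
  by split=> k kl; apply: ll; rewrite mem_cat kl ?orbT.
pose P (l : seq G) x := exists k, [/\ k \in l, C k & U (k^-1 * x)%g].
have [l _ lP] : \near F, C `<=` P F.
  apply: cC => x Cx; exists ([set y | U (x^-1 * y)%g], [set l' : seq G | x \in l']).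
    split=> /=; last first.
      by exists [:: x] => // l /= xl; apply: xl; rewrite mem_head.
    by apply/nbhs_translate; apply: filterS U1 => y /=; rewrite mulKg.
  by move=> [y l] /= [Uy xl]; exists x.
exists [seq k <- l | `[< C k >]] => [k|x Cx].
  by rewrite mem_filter => /andP[/asboolP].
have [//|k [kl Ck Uk]] := lP l _ x Cx.
by exists k => //; rewrite mem_filter kl andbT; apply/asboolP.
Qed.

Lemma compact_mulg A B : compact A -> compact B ->
  compact [set z | exists x y, [/\ A x, B y & z = (x * y)%g]].
Proof.
move=> cA cB.
have -> : [set z | exists x y, [/\ A x, B y & z = (x * y)%g]] =
    (fun u : G * G => (u.1 * u.2)%g) @` (A `*` B).
  apply/seteqP; split=> [_ [x [y [Ax By ->]]]|_ [[x y] [Ax By] <-]].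
    by exists (x, y).
  by exists x, y.
apply: continuous_compact; last exact: compact_setX.
by apply: continuous_subspaceT; exact: mulg_continuous.
Qed.

Lemma compact_translate a A : compact A -> compact [set x | A (a * x)%g].
Proof.
move=> cA.
have -> : [set x | A (a * x)%g] = (fun x => a^-1 * x)%g @` A.
  apply/seteqP; split=> [x Ax|_ [y Ay <-]] /=; last by rewrite mulVKg.
  by exists (a * x)%g => //; rewrite mulKg.
apply: continuous_compact => //.
by apply: continuous_subspaceT; exact: mulg_continuous_left.
Qed.

End TopologicalGroups.

Lemma continuous_morphism (G H : topologicalGroupType) (f : G -> H) :
  {morph f : x y / (x * y)%g} ->
  (forall V : set H, nbhs 1%g V -> nbhs 1%g (f @^-1` V)) -> continuous f.
Proof.
move=> fM f1 x V /nbhs_translate/f1 xV.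
apply: (iffRL (nbhs_translate x (f @^-1` V))).
by apply: filterS xV => y /=; rewrite fM.
Qed.

Section InvariantMetric.
Variables (R : realType) (G : topologicalGroupType) (d : G -> G -> R).
Hypotheses (dP : is_pseudometric d) (dL : left_invariant d).

Lemma inv_distM x y : d 1%g (x * y)%g <= d 1%g x + d 1%g y.
Proof.
apply: le_trans (pseudometric_triangle dP _ x _) _.
by rewrite lerD2l -[leLHS](dL x^-1%g) mulVg mulKg.
Qed.

Lemma inv_distV x : d 1%g x^-1%g = d 1%g x.
Proof. by rewrite -(dL x) mulg1 mulgV (pseudometric_sym dP). Qed.

Lemma inv_distE x y : d x y = d 1%g (x^-1 * y)%g.
Proof. by rewrite -(dL x^-1%g) mulVg. Qed.

Lemma left_invariant_nbhs : induces_topology d ->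
  forall x U, nbhs x U <-> exists2 e, 0 < e & forall y, d x y < e -> U y.
Proof. by move=> dT x U; rewrite dT. Qed.

End InvariantMetric.

(** * Open subgroups and characters of Boolean groups *)

Section BooleanGroups.
Variables (R : realType) (G : topologicalGroupType) (d : G -> G -> R).
Hypotheses (mulC : abelian_group G) (sqG : boolean_group G).
Hypotheses (dP : is_pseudometric d) (dL : left_invariant d).
Hypothesis dT : induces_topology d.

Let mulgg := boolean_mulgg sqG.
Let invg := boolean_invg sqG.
Local Notation N := (d 1%g).

Lemma boolean_mulK (x y : G) : (x * (x * y) = y)%g.
Proof. by rewrite mulgA mulgg mul1g. Qed.

(** Cover the product of [C] with itself by finitely many translates of [C]. The union of the
    translates of [C] by the finite group spanned by their centres then absorbs products. *)
Lemma compact_open_subgroup (C : set G) : compact C -> nbhs 1%g C ->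
  exists K : set G, [/\ compact K, nbhs 1%g K, C `<=` K &
    forall x y, K x -> K y -> K (x * y)%g].
Proof.
move=> cC C1; have [ks _ CC] := compact_translates (compact_mulg cC cC) C1.
pose K := [set x | exists2 g, g \in span ks & C (g * x)%g].
have CK : C `<=` K by move=> x Cx; exists 1%g; rewrite ?span1 ?mul1g.
exists K; split => //; last 2 first.
- by apply: filterS C1.
- move=> x y [g gs Cgx] [h hs Chy].
  have [|k kks] := CC (g * x * (h * y))%g; first by exists (g * x)%g, (h * y)%g.
  rewrite invg => Ck; exists (k * (g * h))%g.
    by do! apply: spanM => //; exact: mem_span.
  by move: Ck; congr C; rewrite -!mulgA; congr (_ * (_ * _))%g; rewrite mulC -mulgA (mulC y).
rewrite /K; elim: (span ks) => [|g s IH].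
  rewrite (_ : mkset _ = set0); first exact: compact0.
  by apply/seteqP; split => // x [].
rewrite (_ : mkset _ = [set x | C (g * x)%g] `|`
    [set x | exists2 g, g \in s & C (g * x)%g]); last first.
  apply/seteqP; split=> [x [h]|x [Cx|[h hs Cx]]].
  - by rewrite inE => /predU1P[->|hs Cx]; [left|right; exists h].
  - by exists g; rewrite ?mem_head.
  - by exists h; rewrite // inE hs orbT.
by apply: compactU => //; exact: compact_translate.
Qed.

(* Averaging over the finite group spanned by ys and a finite net of K plays the
   role of Haar measure: the correlation u of a bump function theta with itself
   satisfies u x * u (x z) = 0 if the product z of ys is far from 1, while
   conv_defect_le bounds the sum of u ^ 2 by a constant depending only on the
   closeness of the elements of ys to 1, and the net bounds it from below. *)
Lemma small_open_subgroup (K : set G) (r : R) : compact K -> nbhs 1%g K ->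
  (forall x y, K x -> K y -> K (x * y)%g) -> 0 < r ->
  exists V : set G, [/\ nbhs 1%g V, V `<=` K, forall x, V x -> N x < r &
    forall x y, V x -> V y -> V (x * y)%g].
Proof.
(* The correlation [u] lives where [N x < 2 * e]; if it is nonzero at both [x] and [x * z], then
   [N z < 4 * e = r]. *)
move=> cK K1 KM r0; pose e := r / 4; have e0 : 0 < e by rewrite divr_gt0.
have N0 x : 0 <= N x by exact: pseudometric_ge0.
have NM x y : N (x * y)%g <= N x + N y by exact: inv_distM.
pose theta x := Num.max 0 (1 - N x / e).
have th0 x : 0 <= theta x by rewrite le_max lexx.
have th1 x : theta x <= 1.
  by rewrite ge_max ler01 lerBlDr lerDl divr_ge0 // ltW.
have thN x : 2^-1 * e >= N x -> 2^-1 <= theta x.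
  move=> Nx; rewrite le_max; apply/orP; right.
  by rewrite -(ler_pM2r e0) mulrBl divfK ?gt_eqF //; lra.
have thS x : theta x != 0 -> N x < e.
  apply: contraNT; rewrite -leNgt => Nx; apply/eqP/max_idPl.
  by rewrite subr_le0 ler_pdivlMr // mul1r.
have thL x y : `|theta (x * y)%g - theta x| <= N y / e.
  have h1 : N (x * y)%g / e <= N x / e + N y / e.
    by rewrite -mulrDl ler_pM2r ?invr_gt0.
  have h2 : N x / e <= N (x * y)%g / e + N y / e.
    rewrite -mulrDl ler_pM2r ?invr_gt0 //.
    by apply: le_trans (NM _ _); rewrite -mulgA mulgg mulg1.
  have Ny : 0 <= N y / e by rewrite divr_ge0 // ltW.
  rewrite /theta; move: h1 h2 Ny; move: (N _ / e) (N x / e) (N y / e) => a b t.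
  move=> h1 h2 t0; rewrite ler_norml.
  case: (leP 0 (1 - a)) => ha; case: (leP 0 (1 - b)) => hb; apply/andP; split; lra.
have [|ks ksK Kks] := @compact_translates _ _ [set x | N x < 2^-1 * e] cK.
  by apply/(left_invariant_nbhs dT); exists (2^-1 * e); rewrite ?mulr_gt0 ?invr_gt0.
pose k : R := (size ks)%:R.
have k0 : 0 < k.
  have [|g gks _] := Kks 1%g; first exact: nbhs_singleton.
  by rewrite ltr0n; case: ks gks {k Kks ksK}.
(* With this [c], [c ^+ 2 / 2 * k ^+ 4] equals 1/32, below the 1/16 that the net of [K] provides. *)
pose c := (4 * k ^+ 2)^-1.
have c0 : 0 < c by rewrite invr_gt0 mulr_gt0 ?exprn_gt0.
pose V0 := [set y | K y /\ N y < c * e].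
(* Products of any length are allowed, as the bound of [conv_defect_le] does not depend on the
   length. *)
pose V := [set x | exists2 ys, {in ys, forall y, V0 y} & x = prodg ys].
have VM x y : V x -> V y -> V (x * y)%g.
  move=> [l lV ->] [l' l'V ->]; exists (l ++ l').
    by move=> z; rewrite mem_cat => /orP[/lV|/l'V].
  by elim: l {lV} => [|z l IH] /=; rewrite ?mul1g // -mulgA IH.
have K11 : K 1%g by exact: nbhs_singleton.
have VK : V `<=` K.
  move=> _ [ys ysV ->]; elim: ys ysV => //= y ys IH ysV.
  apply: KM; first by case: (ysV y); rewrite ?mem_head.
  by apply: IH => z zys; apply: ysV; rewrite inE zys orbT.
exists V; split => //.
  have : nbhs 1%g V0.
    apply: filterI => //; apply/(left_invariant_nbhs dT).
    by exists (c * e); rewrite // mulr_gt0.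
  apply: filterS => y Vy; exists [:: y]; rewrite /= ?mulg1 // => z.
  by rewrite inE => /eqP ->.
move=> _ [ys ysV ->]; rewrite ltNge; apply/negP => rN.
set z := prodg ys in rN; pose s := span (ys ++ ks); pose n : R := (size s)%:R.
have n0 : 0 < n.
  by rewrite ltr0n /s; case: (span _) (span1 (ys ++ ks)).
have sK : {in s, forall x, K x}.
  apply: span_closed => // x; rewrite mem_cat => /orP[/ysV[]|/ksK] //.
have st : {in ys ++ ks, forall x, stab s x} by exact: stab_span.
have sst : {in s, forall x, stab s x} by exact: mem_span_stab.
pose u := conv s theta theta; pose A := \sum_(x <- s) theta x.
have uS x : u x != 0 -> N x < 2 * e.
  apply: contraNT; rewrite -leNgt => Nx; apply/eqP/big1 => g _.
  have [->|/thS Ng] := eqVneq (theta g) 0; first by rewrite mulr0.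
  have [->|/thS Ngx] := eqVneq (theta (g * x)%g) 0; first by rewrite mul0r.
  have := NM g (g * x)%g; rewrite boolean_mulK; lra.
have u0 x : u x * u (x * z)%g = 0.
  apply/eqP; apply: contraTT rN; rewrite mulf_eq0 negb_or -ltNge => /andP[/uS h /uS h'].
  have := NM x (x * z)%g; rewrite boolean_mulK /e in h h' *; lra.
have yst : {in ys, forall y, stab s y /\
    forall x, `|theta (x * y)%g - theta x| <= c}.
  move=> y yys; split; first by apply: st; rewrite mem_cat yys.
  move=> x; apply: le_trans (thL x y) _; rewrite ler_pdivrMr //.
  by case: (ysV y yys) => _ /ltW.
have th2 : \sum_(x <- s) theta x ^+ 2 <= n.
  have -> : n = \sum_(x <- s) 1.
    by rewrite big_const_seq count_predT iter_addr addr0.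
  by apply: ler_sum => x _; rewrite expr_le1.
have := conv_defect_le mulC sqG yst theta; rewrite -/u -/z -/n => le1.
have {le1} le1 : \sum_(x <- s) u x ^+ 2 <= c ^+ 2 / 2 * n ^+ 3.
  rewrite (eq_bigr (fun x => u x * (u x - u (x * z)%g))); last first.
    by move=> x _; rewrite mulrBr u0 subr0.
  apply: le_trans le1 _.
  have -> : c ^+ 2 / 2 * n ^+ 3 = c ^+ 2 / 2 * n ^+ 2 * n by ring.
  apply: ler_wpM2l => //.
  by apply: mulr_ge0; [apply: divr_ge0|]; rewrite ?sqr_ge0 ?ler0n.
have uA : \sum_(x <- s) u x = A ^+ 2.
  rewrite /u /conv exchange_big /= expr2 {2}/A mulr_sumr.
  apply: eq_big_seq => g gs; rewrite -mulr_suml; congr (_ * _).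
  by rewrite /A -(sum_shift mulC theta (sst g gs)); apply: eq_bigr => x _; rewrite mulC.
(* Each point of [s] lies in [K], hence within [e / 2] of a point of the net, which contributes at
   least 1/2. *)
have nA : n / 2 <= k * A.
  have -> : k * A = \sum_(x <- s) \sum_(g <- ks) theta (g * x)%g.
    rewrite exchange_big /= (eq_big_seq (fun _ => A)) => [|g gks].
      by rewrite big_const_seq count_predT iter_addr addr0 mulr_natl.
    have sg : stab s g by apply: st; rewrite mem_cat gks orbT.
    by rewrite /A -(sum_shift mulC theta sg); apply: eq_bigr => x _; rewrite mulC.
  have -> : n / 2 = \sum_(x <- s) 2^-1.
    by rewrite big_const_seq count_predT iter_addr addr0 mulrC mulr_natr.
  rewrite big_seq [leRHS]big_seq; apply: ler_sum => x xs.
  have [g gks /ltW Ngx] := Kks x (sK x xs); rewrite invg in Ngx.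
  rewrite (big_rem g) //=; apply: le_trans (thN _ Ngx) _.
  by rewrite lerDl sumr_ge0.
have := sqr_sum_le s u; rewrite uA -/n => le2.
have A0 : 0 <= A by apply: sumr_ge0 => x _.
have le3 : (A ^+ 2) ^+ 2 <= n * (c ^+ 2 / 2 * n ^+ 3).
  by apply: le_trans le2 _; rewrite ler_pM2l.
have le4 : n ^+ 4 / 16 <= k ^+ 4 * (A ^+ 2) ^+ 2.
  have -> : n ^+ 4 / 16 = (n / 2) ^+ 4 by field.
  have -> : k ^+ 4 * (A ^+ 2) ^+ 2 = (k * A) ^+ 4 by ring.
  by rewrite lerXn2r ?nnegrE ?divr_ge0 ?mulr_ge0 // ltW.
have k4 : 0 < k ^+ 4 by rewrite exprn_gt0.
have : k ^+ 4 * (A ^+ 2) ^+ 2 <= n ^+ 4 / 32.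
  apply: le_trans (_ : k ^+ 4 * (n * (c ^+ 2 / 2 * n ^+ 3)) <= _).
    by rewrite ler_pM2l.
  suff -> : k ^+ 4 * (n * (c ^+ 2 / 2 * n ^+ 3)) = n ^+ 4 / 32 by [].
  by rewrite /c; field; rewrite gt_eqF.
have : 0 < n ^+ 4 by rewrite exprn_gt0.
lra.
Qed.

Definition adjoin (M : set G) (g : G) := [set x | M x \/ M (g * x)%g].

Lemma adjoinM (M : set G) g : (forall x y, M x -> M y -> M (x * y)%g) ->
  forall x y, adjoin M g x -> adjoin M g y -> adjoin M g (x * y)%g.
Proof.
move=> MM x y [Mx|Mx] [My|My]; [left|right|right|left].
- exact: MM.
- by rewrite (mulC x) mulgA (mulC (g * y)%g); exact: MM.
- by rewrite mulgA; exact: MM.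
- have -> : (x * y = g * x * (g * y))%g; last exact: MM.
  by rewrite (mulC g x) -mulgA boolean_mulK.
Qed.

(** Enlarge [V] by the [h n] one at a time as long as [e] stays outside. Every coset of [V] contains
    some [h n], so the union [U] contains [x] or [e * x] for every [x]. It thus has index two, and
    [chi] is the indicator of its complement. *)
Lemma exists_character (V : set G) (h : nat -> G) (e : G) :
  V 1%g -> (forall x y, V x -> V y -> V (x * y)%g) ->
  (forall x, exists n, V (h n * x)%g) -> ~ V e ->
  exists chi : G -> bool, [/\ forall x y, chi (x * y)%g = chi x (+) chi y,
    forall x, V x -> chi x = false & chi e = true].
Proof.
move=> V1 VM hV Ve.
pose step M g := if pselect (adjoin M g e) then M else adjoin M g.
pose M := fix M n := if n is n'.+1 then step (M n') (h n') else V.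
have MM n : forall x y, M n x -> M n y -> M n (x * y)%g.
  by elim: n => //= n IH; rewrite /step; case: pselect => [?|?] //; exact: adjoinM.
have MS n x : M n x -> M n.+1 x.
  by move=> Mx /=; rewrite /step; case: pselect => [?|?] //; left.
have Mle m n x : (m <= n)%N -> M m x -> M n x.
  move=> /subnK <-; elim: (n - m)%N => // k IH Mx.
  by rewrite addSn; apply: MS; exact: IH.
have Me n : ~ M n e.
  by elim: n => //= n IH; rewrite /step; case: pselect.
pose U := [set x | exists n, M n x].
have UM x y : U x -> U y -> U (x * y)%g.
  move=> [m Mx] [n My]; exists (maxn m n); apply: MM.
    by apply: Mle Mx; exact: leq_maxl.
  by apply: Mle My; exact: leq_maxr.
have Ue : ~ U e by move=> [n /Me].
(* If adjoining [h n] would have captured [e], then [h n * e] is in [M n], and so is its product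
   with [h n * x], which is [e * x]. *)
have Uor x : U x \/ U (e * x)%g.
  have [n Vx] := hV x; have Mx : M n (h n * x)%g by apply: (@Mle 0%N).
  have [] := pselect (adjoin (M n) (h n) e) => [[/Me //|Mhe]|Nadj].
    right; exists n; have -> : (e * x = h n * e * (h n * x))%g; last exact: MM.
    by rewrite (mulC (h n) e) -mulgA boolean_mulK.
  by left; exists n.+1; rewrite /= /step; case: pselect => [?|?] //; right.
exists (fun x => ~~ `[< U x >]); split; last 2 first.
- by move=> x Vx; apply/negbF/asboolP; exists 0%N.
- exact/asboolP.
move=> x y; have notU z : ~ U z -> U (e * z)%g by move=> Uz; case: (Uor z).
have Uxx z t : U z -> U (z * t)%g -> U t.
  by move=> Uz Uzt; rewrite -(boolean_mulK z t); exact: UM.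
case: (asboolP (U x)) => Ux; case: (asboolP (U y)) => Uy /=.
- by apply/negbF/asboolP; exact: UM.
- by apply/asboolP => Uxy; apply: Uy; exact: Uxx Uxy.
- by apply/asboolP => Uxy; apply: Ux; apply: (Uxx y); rewrite // mulC.
- apply/negbF/asboolP; have := UM _ _ (notU _ Ux) (notU _ Uy).
  by rewrite (mulC e x) -mulgA boolean_mulK.
Qed.

End BooleanGroups.

(** * Coordinates on locally compact Boolean groups *)

(* An isomorphism of B with (Z/2) x (Z/2)^S x (Z/2)^(T) that sends p to
   (1, 0, 0), the last factor being a discrete direct sum; chi n and f n carry
   no information for n outside S and T. *)
Record coordinates (S T : set nat) (B : topologicalGroupType) (p : B)
    (c : B -> bool) (chi f : nat -> B -> bool) : Prop := Coordinates {
  coord_cM : forall x y, c (x * y)%g = c x (+) c y ;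
  coord_chiM : forall n x y, chi n (x * y)%g = chi n x (+) chi n y ;
  coord_fM : forall n x y, f n (x * y)%g = f n x (+) f n y ;
  coord_cp : c p = true ;
  coord_chip : forall n, S n -> chi n p = false ;
  coord_fp : forall n, T n -> f n p = false ;
  coord_eq1 : forall x, c x = false -> (forall n, S n -> chi n x = false) ->
    (forall n, T n -> f n x = false) -> x = 1%g ;
  coord_fin : forall x, exists N, forall n, T n -> (N <= n)%N -> f n x = false ;
  coord_surj : forall b u v, (exists N, forall n, (N <= n)%N -> v n = false) ->
    exists x, [/\ c x = b, forall n, S n -> chi n x = u n &
                  forall n, T n -> f n x = v n] ;
  coord_nbhs : forall A, nbhs 1%g A <-> exists N, forall x, c x = false ->
    (forall n, S n -> (n < N)%N -> chi n x = false) ->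
    (forall n, T n -> f n x = false) -> A x }.

Lemma card_eq_nat_bij (S S' : set nat) : (S #= S')%card ->
  exists s s' : nat -> nat,
    (forall n, S n -> S' (s n) /\ s' (s n) = n) /\
    (forall n, S' n -> S (s' n) /\ s (s' n) = n).
Proof.
move=> /ppcard_eqP[g]; exists g, (g^-1)%FUN; split=> n Sn; split.
- exact: funS.
- by apply: funK; apply/mem_set.
- exact: invS.
- by apply: invK; apply/mem_set.
Qed.

Lemma compact_seq_cluster (X : topologicalType) (K : set X) (u : nat -> X) :
  compact K -> (forall n, K (u n)) ->
  exists2 y, K y & forall W N, nbhs y W -> exists2 n, (N <= n)%N & W (u n).
Proof.
move=> cK Ku; have [|y [Ky uy]] := cK (u @ \oo) _.
  by exists 0%N => // n _; exact: Ku.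
exists y => // W N Wy.
have [|_ [[n Nn <-] Wun]] := uy [set x | exists2 n, (N <= n)%N & u n = x] W _ Wy.
  by exists N => // n Nn; exists n.
by exists n.
Qed.

Lemma coord_inj S T (B : topologicalGroupType) p c chi f (x y : B) :
  coordinates S T p c chi f -> boolean_group B -> c x = c y ->
  (forall n, S n -> chi n x = chi n y) -> (forall n, T n -> f n x = f n y) ->
  x = y.
Proof.
move=> co sqB cxy chixy fxy; have xy1 : (x * y = 1)%g.
  apply: (coord_eq1 co) => [|n Sn|n Tn].
  - by rewrite (coord_cM co) cxy addbb.
  - by rewrite (coord_chiM co) chixy // addbb.
  - by rewrite (coord_fM co) fxy // addbb.
by rewrite -[x]mulg1 -(boolean_mulgg sqB y) mulgA xy1 mul1g.
Qed.

Section CoordinatesMap.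
Variables (S T S' T' : set nat) (B B' : topologicalGroupType).
Variables (p : B) (p' : B') (c : B -> bool) (c' : B' -> bool).
Variables (chi f : nat -> B -> bool) (chi' f' : nat -> B' -> bool).
Hypothesis co : coordinates S T p c chi f.
Hypothesis co' : coordinates S' T' p' c' chi' f'.

Lemma coord_map (t s' t' : nat -> nat) :
  (forall n, T n -> t' (t n) = n) ->
  (forall n, T' n -> T (t' n) /\ t (t' n) = n) ->
  exists phi : B -> B', [/\ forall x, c' (phi x) = c x,
    forall x n, S' n -> chi' n (phi x) = chi (s' n) x &
    forall x n, T' n -> f' n (phi x) = f (t' n) x].
Proof.
move=> tK t'P.
suff /choice[phi phiP] : forall x, exists y, [/\ c' y = c x,
    forall n, S' n -> chi' n y = chi (s' n) x &
    forall n, T' n -> f' n y = f (t' n) x].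
  by exists phi; split=> x; case: (phiP x).
move=> x; have [N fN] := coord_fin co x.
(* The cut-off outside [T'] gives [v] a finite support: on [T'], [t' n < N] leaves finitely many
   values for [n = t (t' n)]. *)
pose v n := `[< T' n >] && f (t' n) x.
have [|y [cy chiy fy]] := coord_surj co' (c x) (fun n => chi (s' n) x) (v := v).
  exists (\max_(m < N) (t m).+1) => n; rewrite /v; case: asboolP => //= T'n nN.
  have [Tt' tt'] := t'P n T'n; apply: fN => //; rewrite leqNgt.
  apply: contraTN nN => t'N; rewrite -ltnNge -tt'.
  exact: (@leq_bigmax _ (fun m : 'I_N => (t m).+1) (Ordinal t'N)).
exists y; split=> // n T'n; rewrite fy // /v.
by case: asboolP.
Qed.

Lemma coord_map_continuous (phi : B -> B') (s' t' : nat -> nat) :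
  boolean_group B' ->
  (forall n, S' n -> S (s' n)) -> (forall n, T' n -> T (t' n)) ->
  (forall x, c' (phi x) = c x) ->
  (forall x n, S' n -> chi' n (phi x) = chi (s' n) x) ->
  (forall x n, T' n -> f' n (phi x) = f (t' n) x) ->
  [/\ {morph phi : x y / (x * y)%g}, phi p = p' & continuous phi].
Proof.
move=> sqB' Ss Tt cphi chiphi fphi.
have phiM : {morph phi : x y / (x * y)%g}.
  move=> x y; apply: (coord_inj co') => // [|n Sn|n Tn].
  - by rewrite (coord_cM co') !cphi (coord_cM co).
  - by rewrite (coord_chiM co') !chiphi // (coord_chiM co).
  - by rewrite (coord_fM co') !fphi // (coord_fM co).
split=> //.
  apply: (coord_inj co') => // [|n Sn|n Tn].
  - by rewrite cphi (coord_cp co) (coord_cp co').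
  - by rewrite chiphi // (coord_chip co) ?(coord_chip co') //; exact: Ss.
  - by rewrite fphi // (coord_fp co) ?(coord_fp co') //; exact: Tt.
apply: continuous_morphism => // V /(coord_nbhs co')[N' NV].
apply/(coord_nbhs co); exists (\max_(n < N') (s' n).+1) => x cx chix fx.
apply: NV => [|n Sn nN|n Tn]; rewrite ?cphi // ?fphi //; last exact/fx/Tt.
rewrite chiphi // chix //; first exact: Ss.
exact: (@leq_bigmax _ (fun m : 'I_N' => (s' m).+1) (Ordinal nN)).
Qed.

End CoordinatesMap.

(** Reindexing the coordinates along the bijections gives mutually inverse maps; [coord_inj] makes
    them morphisms and [coord_nbhs] makes them continuous. *)
Lemma coordinates_iso S T S' T' (B B' : topologicalGroupType) p c chi f p' c' chi' f' :
  boolean_group B -> boolean_group B' ->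
  @coordinates S T B p c chi f -> @coordinates S' T' B' p' c' chi' f' ->
  (S #= S')%card -> (T #= T')%card ->
  exists (phi : B -> B') (psi : B' -> B),
    [/\ {morph phi : x y / (x * y)%g}, cancel phi psi, cancel psi phi,
        continuous phi & continuous psi] /\ phi p = p'.
Proof.
move=> sqB sqB' co co' /card_eq_nat_bij[s [s' [sP s'P]]].
move=> /card_eq_nat_bij[t [t' [tP t'P]]].
have [|phi [cphi chiphi fphi]] := coord_map co co' s' (t := t) (t' := t') _ t'P.
  by move=> n /tP[].
have [|psi [cpsi chipsi fpsi]] := coord_map co' co s (t := t') (t' := t) _ tP.
  by move=> n /t'P[].
have [||phiM phip phic] := coord_map_continuous co co' sqB' _ _ cphi chiphi fphi.
- by move=> n /s'P[].
- by move=> n /t'P[].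
have [||psiM psip psic] := coord_map_continuous co' co sqB _ _ cpsi chipsi fpsi.
- by move=> n /sP[].
- by move=> n /tP[].
exists phi, psi; split => //; split => // x.
- apply: (coord_inj co) => // [|n Sn|n Tn]; first by rewrite cpsi cphi.
    by rewrite chipsi // chiphi; [rewrite (sP n Sn).2|exact: (sP n Sn).1].
  by rewrite fpsi // fphi; [rewrite (tP n Tn).2|exact: (tP n Tn).1].
- apply: (coord_inj co') => // [|n Sn|n Tn]; first by rewrite cphi cpsi.
    by rewrite chiphi // chipsi; [rewrite (s'P n Sn).2|exact: (s'P n Sn).1].
  by rewrite fphi // fpsi; [rewrite (t'P n Tn).2|exact: (t'P n Tn).1].
Qed.

Section ExistsCoordinates.
Variables (R : realType) (B : topologicalGroupType) (d : B -> B -> R).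
Hypotheses (mulC : abelian_group B) (sqB : boolean_group B).
Hypotheses (dP : is_pseudometric d) (dL : left_invariant d).
Hypothesis dT : induces_topology d.
Hypothesis d0 : forall x y, d x y = 0 -> x = y.

Let mulgg := boolean_mulgg sqB.
Let mulK := boolean_mulK sqB.
Local Notation N := (d 1%g).

(** One character [c] detects [p]; the others are corrected by [c] so as to kill [p]. A pair
    [(m, n)] with [h m] outside [V n] indexes a character that is trivial on [V n] and detects
    [h m]; any [x] outside [V n] shares its coset with such an [h m]. *)
Lemma characters_separate (h : nat -> B) (p : B) (K : set B) :
  (forall x U, nbhs 1%g U -> exists n, U (h n * x)%g) -> p <> 1%g ->
  compact K -> nbhs 1%g K -> (forall x y, K x -> K y -> K (x * y)%g) ->
  exists (c : B -> bool) (chi : nat -> B -> bool),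
  [/\ forall x y, c (x * y)%g = c x (+) c y,
      forall n x y, chi n (x * y)%g = chi n x (+) chi n y,
      c p = true /\ nbhs 1%g [set x | c x = false],
      forall n, chi n p = false /\ nbhs 1%g [set x | chi n x = false] &
      forall x, c x = false -> (forall n, chi n x = false) -> x = 1%g].
Proof.
move=> hd p1 cK K1 KM.
have /choice[V VP] : forall n : nat, exists V : set B, [/\ nbhs 1%g V,
    forall x, V x -> N x < n.+1%:R^-1 &
    forall x y, V x -> V y -> V (x * y)%g].
  move=> n; have r0 : 0 < n.+1%:R^-1 :> R by rewrite invr_gt0 ltr0n.
  have [V [V1 _ VN VM]] := small_open_subgroup mulC sqB dP dL dT cK K1 KM r0.
  by exists V.
have V1 n : V n 1%g by case: (VP n) => /nbhs_singleton.
have hV n x : exists m, V n (h m * x)%g by apply: hd; case: (VP n).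
have VM n : forall x y, V n x -> V n y -> V n (x * y)%g by case: (VP n).
have sep x : x <> 1%g -> exists n, ~ V n x.
  move=> x1; have Nx : 0 < N x.
    rewrite lt_neqAle pseudometric_ge0 // andbT eq_sym.
    by apply: contra_not_neq x1 => /d0.
  exists (Num.truncn (N x)^-1); case: (VP (Num.truncn (N x)^-1)) => _ + _ => /[apply].
  apply/negP; rewrite -leNgt -[leRHS]invrK lef_pV2 ?posrE ?invr_gt0 ?ltr0n //.
  exact/ltW/truncnS_gt.
have [n0 /(exists_character mulC sqB (V1 n0) (VM n0) (hV n0))[c [cM cV cp]]] := sep p p1.
have c1 : nbhs 1%g [set x | c x = false].
  by case: (VP n0) => + _ _; apply: filterS => x /cV.
have ch m n : exists chi : B -> bool, [/\ forall x y, chi (x * y)%g = chi x (+) chi y,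
    chi p = false, nbhs 1%g [set x | chi x = false] &
    ~ V n (h m) -> forall x, V n (h m * x)%g -> c x = false -> chi x = true].
  have [Vhm|Vhm] := pselect (V n (h m)).
    by exists (fun _ => false); split => //; apply: filterS filterT.
  have [chi [chiM chiV chih]] := exists_character mulC sqB (V1 n) (VM n) (hV n) Vhm.
  have chi1 : nbhs 1%g [set x | chi x = false].
    by case: (VP n) => + _ _; apply: filterS => x /chiV.
  (* Adding [c] when [chi p] is true makes the value at [p] false and changes nothing on the kernel
     of [c]. *)
  exists (fun x => chi x (+) (chi p && c x)); split=> [x y|||_ x Vx cx].
  - by rewrite chiM cM; case: (chi x) (chi y) (chi p) (c x) (c y) => [] [] [] [] [].
  - by rewrite cp; case: (chi p).
  - by apply: filterS2 chi1 c1 => x /= -> ->; rewrite andbF.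
  - rewrite cx andbF addbF; have := chiV _ Vx; rewrite chiM chih.
    by case: (chi x).
pose dec k : nat * nat := odflt (0%N, 0%N) (unpickle k).
have /choice[chi chiP] := fun k => ch (dec k).1 (dec k).2.
exists c, chi; split=> // [n x y|n|x cx chix].
- by case: (chiP n).
- by case: (chiP n).
apply: contrapT => /sep[n Vx]; have [m Vmx] := hV n x.
have Vm : ~ V n (h m) by move=> Vm; apply: Vx; rewrite -(mulK (h m) x); exact: VM.
have [_ _ _] := chiP (pickle (m, n)); rewrite /dec pickleK /= => /(_ Vm x Vmx cx).
by rewrite chix.
Qed.

(* S and T are chosen so that the systems are triangular: S consists of the n for
   which chi n is independent of the previous characters on the compact open
   subgroup K, and T of the n for which h n is new modulo K and the previous
   h m. *)
Lemma exists_coordinates (h : nat -> B) (p : B) (C : set B) :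
  (forall x U, nbhs 1%g U -> exists n, U (h n * x)%g) -> p <> 1%g ->
  compact C -> nbhs 1%g C ->
  exists S T c chi f, coordinates S T p c chi f.
Proof.
move=> hd p1 cC C1.
(* With [p] in [K], every [f n] vanishes at [p], and [K] has an element where [c] is true. *)
have [K [cK K1 CK KM]] : exists K : set B, [/\ compact K, nbhs 1%g K,
    C `|` [set p] `<=` K & forall x y, K x -> K y -> K (x * y)%g].
  apply: (compact_open_subgroup mulC sqB).
    by apply: compactU => //; exact: compact_set1.
  by apply: filterS C1 => x; left.
have Kp : K p by apply: CK; right.
have [c [chi [cM chiM [cp c1] chiP eq1]]] := characters_separate hd p1 cK K1 KM.
have chiN n : nbhs 1%g [set x | chi n x = false] by case: (chiP n).
have chip n : chi n p = false by case: (chiP n).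
have nbhs_eq (g : B -> bool) y : (forall x y, g (x * y)%g = g x (+) g y) ->
    nbhs 1%g [set x | g x = false] -> nbhs y [set x | g x = g y].
  move=> gM g1; apply/nbhs_translate; apply: filterS g1 => x /= gx.
  by rewrite gM gx addbF.
have hom1 (g : B -> bool) : (forall x y, g (x * y)%g = g x (+) g y) ->
    g 1%g = false.
  by move=> gM; rewrite -(mulgg 1%g) gM addbb.
have K11 := nbhs_singleton K1.
pose S := [set n | exists e, [/\ K e, c e = false,
  forall m, (m < n)%N -> chi m e = false & chi n e = true]].
pose Kn := fix Kn n := if n is n'.+1 then adjoin (Kn n') (h n') else K.
pose T := [set n | ~ Kn n (h n)].
have KnM n : forall x y, Kn n x -> Kn n y -> Kn n (x * y)%g.
  by elim: n => //= n; exact: adjoinM.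
have KnS m n x : (m <= n)%N -> Kn m x -> Kn n x.
  by move=> /subnK <-; elim: (n - m)%N => // k IH Mx; rewrite addSn; left; exact: IH.
have Kn1 n : Kn n 1%g by apply: (@KnS 0%N).
have Knh n x : exists m, Kn n (h m * x)%g.
  by have [m] := hd x K K1; exists m; apply: (@KnS 0%N).
have /choice[f fP] : forall n, exists f : B -> bool,
    [/\ forall x y, f (x * y)%g = f x (+) f y, forall x, Kn n x -> f x = false &
        T n -> f (h n) = true].
  move=> n; have [Tn|Tn] := pselect (T n); last by exists (fun _ => false).
  have [g [gM gK gh]] := exists_character mulC sqB (Kn1 n) (KnM n) (Knh n) Tn.
  by exists g.
have fM n x y : f n (x * y)%g = f n x (+) f n y by case: (fP n).
have fK n m x : (m <= n)%N -> Kn m x -> f n x = false.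
  by move=> mn Kx; have [_ + _] := fP n; apply; exact: KnS Kx.
have fh n : T n -> f n (h n) = true by case: (fP n).
have Kn_ex x : exists n, Kn n x.
  by have [m Kx] := Knh 0%N x; exists m.+1; right; exact: (@KnS 0%N).
(* Descent along [Kn]: if [h n] is needed to reach [x], then [f n x] is true when [n] is in [T];
   when it is not, [h n] already lies in [Kn n]. *)
have f_kernel x : (forall n, T n -> f n x = false) -> K x.
  move=> fx; have [n] := Kn_ex x; elim: n => // n IH /= [/IH //|Kx].
  have [Tn|Tn] := pselect (T n).
    by have := @fK n n _ (leqnn n) Kx; rewrite fM fh // fx.
  by apply: IH; rewrite -(mulK (h n) x); apply: KnM => //; exact: contrapT.
(* At the first [n] with [chi n x] true, [x] itself witnesses that [n] is in [S]. *)
have eq1S x : K x -> c x = false -> (forall n, S n -> chi n x = false) -> x = 1%g.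
  move=> Kx cx chix; apply: eq1 => // n.
  elim/ltn_ind: n => n IH; case chin: (chi n x) => //.
  have Sn : S n by exists x.
  by rewrite chix in chin.
have /choice[e eP] : forall n, exists x, S n -> [/\ K x, c x = false,
    forall m, (m < n)%N -> chi m x = false & chi n x = true].
  move=> n.
  by have [[x xP]|Sn] := pselect (S n); [exists x|exists 1%g].
(* Triangular system: multiplying by [e M] corrects coordinate [M] and leaves the smaller ones
   alone. In [surjK], compactness of [K] meets all the conditions at once. *)
have surjN b u M : exists x, [/\ K x, c x = b &
    forall n, S n -> (n < M)%N -> chi n x = u n].
  elim: M => [|M [x [Kx cx chix]]].
    by case: b; [exists p|exists 1%g; rewrite hom1].
  have [[SM chiM']|nSM] := pselect (S M /\ chi M x <> u M).
    have [Ke ce chie chiMe] := eP M SM; exists (x * e M)%g; split.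
    - exact: KM.
    - by rewrite cM ce addbF.
    move=> n Sn; rewrite ltnS leq_eqVlt chiM => /predU1P[->|nM].
      by rewrite chiMe; case: (chi M x) (u M) chiM' => [] [].
    by rewrite chie // addbF chix.
  exists x; split=> // n Sn; rewrite ltnS leq_eqVlt => /predU1P[nM|]; last exact: chix.
  by apply: contrapT => ne; apply: nSM; rewrite -nM.
have surjK b u : exists x, [/\ K x, c x = b & forall n, S n -> chi n x = u n].
  have /choice[x xP] := surjN b u.
  have [|y Ky yP] := @compact_seq_cluster _ _ x cK; first by move=> n; case: (xP n).
  exists y; split=> // [|n Sn].
    by have [n _ /= <-] := yP _ 0%N (nbhs_eq c y cM c1); case: (xP n).
  have [m nm /= <-] := yP _ n.+1 (nbhs_eq _ y (chiM n) (chiN n)).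
  by case: (xP m) => _ _; apply.
(* The triangle points the other way: [h M] has no coordinate above [M], and its coordinates below
   [M] are compensated in advance by [v']. *)
have surjT M v : (forall n, (M <= n)%N -> v n = false) ->
    exists y, forall n, T n -> f n y = v n.
  elim: M v => [v v0|M IH v vM].
    by exists 1%g => n Tn; rewrite v0 // hom1.
  pose w := T M /\ v M = true.
  pose v' n := if (n < M)%N then v n (+) (`[< w >] && f n (h M)) else false.
  have [|y yP] := IH v'; first by move=> n; rewrite /v' ltnNge => ->.
  exists (if `[< w >] then y * h M else y)%g => n Tn.
  move: yP; rewrite /v'; case: asboolP => [[TM vMt]|nw] yP; rewrite ?fM yP //=;
    case: ltngtP => //= [_|Mn|nM].
  - by rewrite -addbA addbb addbF.
  - by rewrite (vM n) // (@fK n M.+1) //; right; rewrite mulgg.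
  - by rewrite -nM fh // nM vMt.
  - by rewrite addbF.
  - by rewrite (vM n).
  - by apply/esym/negP => vt; apply: nw; rewrite /w -nM.
exists S, T, c, chi, f; split=> //.
- by move=> n _; apply: (@fK n 0%N).
- by move=> x cx chix fx; apply: eq1S => //; exact: f_kernel.
- by move=> x; have [M KM'] := Kn_ex x; exists M => n _ Mn; exact: fK KM'.
- move=> b u v [M vM]; have [y fy] := surjT M v vM.
  have [k [Kk ck chik]] := surjK (b (+) c y) (fun n => u n (+) chi n y).
  exists (y * k)%g; split=> [|n Sn|n Tn].
  + by rewrite cM ck addbCA addbb addbF.
  + by rewrite chiM chik // addbCA addbb addbF.
  + by rewrite fM fy // (@fK n 0%N) // addbF.
move=> A; split=> [A1|[M MA]].
  (* If no bound worked, points of [K] outside [A] with ever more vanishing coordinates would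
     cluster at [1]. *)
  apply: contrapT => /forallNP nA.
  have /choice[x xP] : forall M, exists x, [/\ K x, c x = false,
      forall n, S n -> (n < M)%N -> chi n x = false & ~ A x].
    move=> M; apply: contrapT => nx; apply: (nA M) => x cx chix fx.
    by apply: contrapT => Ax; apply: nx; exists x; split => //; exact: f_kernel.
  have [|y Ky yP] := @compact_seq_cluster _ _ x cK; first by move=> n; case: (xP n).
  have y1 : y = 1%g.
    apply: eq1S => // [|n Sn].
      by have [n _ /= <-] := yP _ 0%N (nbhs_eq c y cM c1); case: (xP n).
    have [m nm /= <-] := yP _ n.+1 (nbhs_eq _ y (chiM n) (chiN n)).
    by case: (xP m) => _ _ + _; apply.
  by have [|n _] := yP A 0%N; [rewrite y1|case: (xP n)].
have : nbhs 1%g [set x | K x /\ (c x = false /\ forall n, (n < M)%N -> chi n x = false)].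
  apply: filterI => //; apply: filterI => //.
  elim: M {MA} => [|M IH]; first by apply: filterS filterT => x _ n.
  apply: filterS2 IH (chiN M) => x IH chix n.
  by rewrite ltnS leq_eqVlt => /predU1P[->|/IH].
apply: filterS => x [Kx [cx chix]]; apply: MA => // [n _ /chix //|n Tn].
exact: (@fK n 0%N).
Qed.

End ExistsCoordinates.

(** * Groups whose elements are conjugate only to themselves and their inverses *)

Record subgroup (G : topologicalGroupType) := Subgroup {
  subgroup_set :> set G ;
  subgroup1 : subgroup_set 1%g ;
  subgroupM : forall x y, subgroup_set x -> subgroup_set y ->
    subgroup_set (x * y)%g ;
  subgroupV : forall x, subgroup_set x -> subgroup_set x^-1%g }.

Definition subgroup_type (G : topologicalGroupType) (H : subgroup G) : Type :=
  set_type (subgroup_set H).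

HB.instance Definition _ (G : topologicalGroupType) (H : subgroup G) :=
  Topological.copy (subgroup_type H) (set_type (subgroup_set H)).

Section SubgroupType.
Variables (G : topologicalGroupType) (H : subgroup G).
Local Notation T := (subgroup_type H).

Definition subg (x : G) (Hx : subgroup_set H x) : T := exist _ x (mem_set Hx).

Definition subg_val (x : T) : G := sval x.

Lemma subg_valP (x : T) : subgroup_set H (subg_val x).
Proof. exact: set_mem (svalP x). Qed.

Lemma subg_val_inj : injective subg_val.
Proof. exact: val_inj. Qed.

Lemma nbhs_subgP (x : T) (U : set T) :
  nbhs x U <-> exists2 V, nbhs (subg_val x) V & subg_val @^-1` V `<=` U.
Proof.
split=> [[_ [[W oW <-] Wx WU]]|[V Vx VU]].
  by exists W => //; exact: open_nbhs_nbhs.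
apply: filterS VU _.
exact: (@initial_continuous T G subg_val x V Vx).
Qed.

Definition subg_mul (x y : T) : T := subg (subgroupM (subg_valP x) (subg_valP y)).
Definition subg_one : T := subg (subgroup1 H).
Definition subg_inv (x : T) : T := subg (subgroupV (subg_valP x)).

Lemma subg_mulA : associative subg_mul.
Proof. by move=> x y z; apply: subg_val_inj; exact: mulgA. Qed.

Lemma subg_mul1 : left_id subg_one subg_mul.
Proof. by move=> x; apply: subg_val_inj; exact: mul1g. Qed.

Lemma subg_mulr1 : right_id subg_one subg_mul.
Proof. by move=> x; apply: subg_val_inj; exact: mulg1. Qed.

Lemma subg_mulV : left_inverse subg_one subg_inv subg_mul.
Proof. by move=> x; apply: subg_val_inj; exact: mulVg. Qed.

Lemma subg_mulrV : right_inverse subg_one subg_inv subg_mul.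
Proof. by move=> x; apply: subg_val_inj; exact: mulgV. Qed.

HB.instance Definition _ := isGroup.Build T
  subg_mulA subg_mul1 subg_mulr1 subg_mulV subg_mulrV.

Lemma subg_mul_continuous : continuous (fun u : T * T => (u.1 * u.2)%g).
Proof.
move=> [x y] U /nbhs_subgP[V /nbhs_mulg[A [B [Ax By AB]]] VU].
exists (subg_val @^-1` A, subg_val @^-1` B).
  by split; apply/nbhs_subgP; [exists A|exists B].
by move=> [z t] [/= Az Bt]; apply: VU; exact: AB.
Qed.

Lemma subg_inv_continuous : continuous (fun x : T => x^-1)%g.
Proof.
move=> x U /nbhs_subgP[V /(@invg_continuous G (subg_val x)) Vx VU].
have : nbhs x (subg_val @^-1` [set y | V y^-1%g]).
  by apply/nbhs_subgP; exists [set y | V y^-1%g].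
by apply: filterS => y Vy; exact: VU.
Qed.

HB.instance Definition _ := isTopologicalGroup.Build T
  subg_mul_continuous subg_inv_continuous.

End SubgroupType.

Definition conjugates_trivial (G : groupType) :=
  forall x g : G, (x * g = g * x \/ x * g = g * x^-1)%g.

Section ConjugatesTrivial.
Variable G : groupType.
Hypothesis conjG : conjugates_trivial G.
Implicit Types a b x y z : G.

Lemma noncomm_mulV a b : (a * b <> b * a -> a * b = b * a^-1)%g.
Proof. by case: (conjG a b). Qed.

Lemma noncomm_sqr a b : (a * b <> b * a -> a * a = b * b)%g.
Proof.
move=> nab; have e1 := noncomm_mulV nab.
have e2 : (b * a = a * b^-1)%g by apply: noncomm_mulV => /esym.
have aba : (a * b * a = b)%g by rewrite e1 -mulgA mulVg mulg1.
have bab : (b * a * b = a)%g by rewrite e2 -mulgA mulVg mulg1.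
by rewrite -{2}bab !mulgA aba.
Qed.

Lemma noncomm_sqr_neq1 a b : (a * b <> b * a -> a * a <> 1)%g.
Proof.
move=> nab aa; apply: nab; case: (conjG a b) => // ->.
by rewrite -[(a^-1)%g]mulg1 -aa mulKg.
Qed.

(** Conjugation by [b] inverts [a * a], yet fixes it because [a * a = b * b]. *)
Lemma noncomm_sqr_sqr a b : (a * b <> b * a -> a * a * (a * a) = 1)%g.
Proof.
move=> nab; have e1 := noncomm_mulV nab.
have e : (b * (a * a) = b * (a * a)^-1)%g.
  rewrite {1}(noncomm_sqr nab) mulgA -(noncomm_sqr nab) -mulgA e1 mulgA e1.
  by rewrite invgM mulgA.
by rewrite {1}(@mulgI _ b _ _ e) mulVg.
Qed.

End ConjugatesTrivial.


(** * Group morphisms and their extension to a twist *)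

Section GroupMorphisms.
Variables (G H : groupType) (phi : G -> H).
Hypothesis phiM : {morph phi : x y / (x * y)%g}.

Lemma morph_one : phi 1%g = 1%g.
Proof. by apply: (@mulgI _ (phi 1%g)); rewrite -phiM !mulg1. Qed.

Lemma morph_inv x : phi x^-1%g = ((phi x)^-1)%g.
Proof. by apply: (@mulgI _ (phi x)); rewrite -phiM !mulgV morph_one. Qed.

End GroupMorphisms.

Section TwistExtension.
Variables (B : basePair) (G : topologicalGroupType) (phi : B -> G) (g : G).
Hypothesis phiM : {morph phi : x y / (x * y)%g}.
Hypothesis gphi : forall x, (g * phi x = (phi x)^-1 * g)%g.
Hypothesis gg : (g * g = phi (base_point B))%g.

(** Universal property of the twist: [phi] extends to it by sending the adjoined element
    [(1, true)], whose square is the base point, to [g]. *)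
Definition twist_extend (u : twist B) : G :=
  (phi u.1 * (if u.2 then g else 1))%g.

Lemma twist_extendM : {morph twist_extend : u v / (u * v)%g}.
Proof.
move=> [x []] [y []]; rewrite /twist_extend twistE /= ?mulg1 ?phiM ?(morph_inv phiM) //.
- by rewrite -!mulgA (mulgA g) gphi -gg !mulgA.
- by rewrite -!mulgA gphi.
- by rewrite mulgA.
Qed.

Lemma twist_extend_continuous : continuous phi -> continuous twist_extend.
Proof.
move=> phic; apply: continuous_morphism; first exact: twist_extendM.
move=> V V1; exists (phi @^-1` V, [set false]).
  split; last by [].
  by apply: (phic 1%g); rewrite (morph_one phiM).
by move=> [x j] [/= Vx ->]; rewrite /twist_extend /= mulg1.
Qed.

End TwistExtension.

(** [x^-1 * a * x] is [a] or [a^-1], which differ because [a * a <> 1]. Being continuous in [x], it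
    equals [a] near [1]. *)
Lemma commute_with_nbhs (G : topologicalGroupType) (a b : G) :
  conjugates_trivial G -> (a * b <> b * a)%g ->
  (forall x y : G, x <> y -> exists2 U, nbhs x U & ~ U y) ->
  nbhs 1%g [set x | x * a = a * x]%g.
Proof.
move=> conjG nab sepG; have [|U Ua UaV] := sepG a a^-1%g.
  by move=> e; apply: (noncomm_sqr_neq1 conjG nab); rewrite {1}e mulVg.
have cc : continuous (fun x => x^-1 * (a * x))%g.
  move=> x; apply: (@continuous_comp _ _ _ (fun x => (x^-1, a * x)%g)
    (fun u : G * G => (u.1 * u.2)%g)); last exact: mulg_continuous.
  by apply: cvg_pair; [exact: invg_continuous|exact: mulg_continuous_left].
have : nbhs 1%g [set x | U (x^-1 * (a * x))%g].
  by apply: (cc 1%g U); rewrite invg1 mul1g mulg1.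
apply: filterS => x /= Ux; have [//|ax] := conjG a x.
by exfalso; apply: UaV; move: Ux; rewrite ax mulKg.
Qed.

(** * Structure of the non-Abelian groups with trivial conjugates *)

Section IsoSingular.
Variables (G : topologicalGroupType) (a b : G).
Hypothesis conjG : conjugates_trivial G.
Hypothesis nab : (a * b <> b * a)%g.
Hypothesis sepG : forall x y : G, x <> y -> exists2 U, nbhs x U & ~ U y.

Let aabb : (a * a = b * b)%g := noncomm_sqr conjG nab.
Let pp : (a * a * (a * a) = 1)%g := noncomm_sqr_sqr conjG nab.
Let ab : (a * b = b * a^-1)%g := noncomm_mulV conjG nab.
Let ba : (b * a = a^-1 * b)%g.
Proof. by apply: (@mulgI _ a); rewrite mulgA ab -mulgA mulVg mulg1 mulVKg. Qed.

Lemma centralizer2M x y : (x * a = a * x /\ x * b = b * x ->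
  y * a = a * y /\ y * b = b * y ->
  x * y * a = a * (x * y) /\ x * y * b = b * (x * y))%g.
Proof.
move=> [xa xb] [ya yb].
by rewrite -!mulgA ya yb !mulgA xa xb.
Qed.

Lemma centralizer2V x : (x * a = a * x /\ x * b = b * x ->
  x^-1 * a = a * x^-1 /\ x^-1 * b = b * x^-1)%g.
Proof.
by move=> [xa xb]; split; apply: (@mulgI _ x); rewrite mulgA mulgV mul1g mulgA
  ?xa ?xb mulgK.
Qed.

Definition centralizer2 : subgroup G :=
  @Subgroup G [set x | x * a = a * x /\ x * b = b * x]%g
    (conj (etrans (mul1g a) (esym (mulg1 a))) (etrans (mul1g b) (esym (mulg1 b))))
    centralizer2M centralizer2V.

Local Notation H := (subgroup_type centralizer2).

(** For [x] in the centralizer, [x * a] and [b] do not commute either, so the square of [x * a] is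
    [b * b = a * a]; it is also [x * x * (a * a)]. *)
Lemma centralizer2_boolean : boolean_group H.
Proof.
move=> z; apply: subg_val_inj; have [za zb] := subg_valP z.
rewrite expg2 /=; set x := subg_val z in za zb *.
have nxab : (x * a * b <> b * (x * a))%g.
  by rewrite (mulgA b) -zb -!mulgA => /mulgI.
have := noncomm_sqr conjG nxab; rewrite -aabb.
have -> : (x * a * (x * a) = x * x * (a * a))%g.
  by rewrite -mulgA (mulgA a) -za !mulgA.
by rewrite -[RHS]mul1g => /mulIg.
Qed.

Lemma centralizer2_abelian : abelian_group H.
Proof.
move=> x y; rewrite -[LHS](boolean_invg centralizer2_boolean) invgM.
by rewrite !(boolean_invg centralizer2_boolean).
Qed.

Lemma centralizer2_sqr : (a * a * a = a * (a * a) /\ a * a * b = b * (a * a))%g.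
Proof. by split; [rewrite mulgA|rewrite aabb mulgA]. Qed.

(** [Defined] keeps the carrier visible to conversion, so that [subg_val] can serve as a map on this
    base pair. *)
Definition centralizer2_basePair : basePair.
Proof.
refine (@BasePair H centralizer2_abelian (@subg G centralizer2 (a * a)%g centralizer2_sqr) _ _).
  exact: centralizer2_boolean.
move=> /(congr1 (@subg_val G centralizer2)) e.
exact: (noncomm_sqr_neq1 conjG nab e).
Defined.

Lemma centralizer2_basePair_boolean : boolean_group centralizer2_basePair.
Proof. exact: centralizer2_boolean. Qed.

Let subg_val_invE (x : H) : ((subg_val x)^-1 = subg_val x)%g.
Proof. by rewrite -[in RHS](boolean_invg centralizer2_boolean x). Qed.

Let e1 := @twist_extend centralizer2_basePair G (@subg_val G centralizer2) a.

Let e1_conj (x : H) : (a * subg_val x = (subg_val x)^-1 * a)%g.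
Proof. by have [xa _] := subg_valP x; rewrite subg_val_invE. Qed.

Let e1M : {morph e1 : x y / (x * y)%g}.
Proof. exact: twist_extendM. Qed.

Let e2 := @twist_extend (twist_basePair centralizer2_basePair_boolean) G e1 b.

Let e2_conj x : (b * e1 x = (e1 x)^-1 * b)%g.
Proof.
case: x => x j; have [xa xb] := subg_valP x; rewrite /e1 /twist_extend /=.
case: j; last by rewrite !mulg1 subg_val_invE xb.
by rewrite {2}xa invgM subg_val_invE -!mulgA -ba !mulgA xb.
Qed.

Let e2_sqr : (b * b = e1 (twist_point centralizer2_basePair))%g.
Proof. by rewrite /e1 /twist_extend /= mulg1 aabb. Qed.

Let e2M : {morph e2 : x y / (x * y)%g}.
Proof. exact: twist_extendM. Qed.

(** A kernel element with a nontrivial sign would make [b] the inverse of an element commuting with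
    [a], or [a] the inverse of one commuting with [b]. *)
Let e2_kernel u : e2 u = 1%g -> u = 1%g.
Proof.
case: u => -[x j] k; have [xa xb] := subg_valP x.
rewrite /e2 /e1 /twist_extend /=; case: k.
  move=> e; exfalso; apply: nab; set y := (_ * (if j then a else 1))%g in e.
  have ya : (y * a = a * y)%g by rewrite /y; case: (j); rewrite ?mulg1 // mulgA -xa.
  have -> : b = y^-1%g by apply: (@mulgI _ y); rewrite e mulgV.
  by apply: (@mulgI _ y); rewrite mulVKg mulgA ya mulgK.
rewrite mulg1; case: j => e.
  exfalso; apply: nab; have -> : a = (subg_val x)^-1%g.
    by apply: (@mulgI _ (subg_val x)); rewrite e mulgV.
  by apply: (@mulgI _ (subg_val x)); rewrite mulVKg mulgA xb mulgK.
by congr (_, _, _); apply: subg_val_inj; rewrite -[LHS]mulg1.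
Qed.

(** If [g] does not commute with [a], then [g * b] does; if [x] commutes with [a] but not with [b],
    then [x * a] commutes with both. At most two multiplications thus lead into the centralizer. *)
Let e2_surj g : exists u, e2 u = g.
Proof.
pose I g := exists u, e2 u = g.
have IM x y : I x -> I y -> I (x * y)%g.
  by move=> [u <-] [v <-]; exists (u * v)%g; exact: e2M.
have IV x : I x -> I x^-1%g.
  move=> [u <-]; exists u^-1%g; exact: (morph_inv e2M).
have Ia : I a.
  by exists ((1%g, true), false); rewrite /e2 /e1 /twist_extend /= mulg1 mul1g.
have Ib : I b.
  by exists (1%g, true); rewrite /e2 /e1 /twist_extend /= mulg1 mul1g.
have IH x : (x * a = a * x -> x * b = b * x -> I x)%g.
  move=> xa xb; exists ((@subg G centralizer2 x (conj xa xb), false), false).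
  by rewrite /e2 /e1 /twist_extend /= !mulg1.
have Ica x : (x * a = a * x -> I x)%g.
  move=> xa; have [|xb] := pselect (x * b = b * x)%g; first exact: IH.
  rewrite -(mulgK a x); apply: IM (IV _ Ia); apply: IH.
    by rewrite {1}xa mulgA.
  have e4 : (b * x = x * b^-1)%g by apply: noncomm_mulV => // /esym.
  have bVa : (b^-1 * a = a^-1 * b^-1)%g.
    by apply: (@mulgI _ b); rewrite mulVKg mulgA; apply: (@mulIg _ b); rewrite -!mulgA mulVg mulg1 ab.
  have abV : (a * b = a^-1 * b^-1)%g.
    apply: (@mulgI _ a); rewrite mulVKg; apply: (@mulIg _ b); rewrite mulVg.
    by rewrite mulgA -(mulgA (a * a)%g) -aabb.
  by rewrite [in RHS]mulgA e4 -!mulgA bVa abV.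
have [|ga] := pselect (g * a = a * g)%g; first exact: Ica.
rewrite -/(I g) -(mulgK b g); apply: IM (IV _ Ib); apply: Ica.
have e4 : (a * g = g * a^-1)%g by apply: noncomm_mulV => // /esym.
by rewrite -mulgA ba mulgA -e4 mulgA.
Qed.

Lemma iso_singular_noncomm : iso_singular G.
Proof.
exists centralizer2_basePair, centralizer2_basePair_boolean.
have [f fK] := choice e2_surj.
have e2K : cancel e2 f.
  move=> u; have := fK (e2 u); move: (f _) => v euv.
  apply: (@mulIg _ u^-1%g); rewrite mulgV; apply: e2_kernel.
  by rewrite e2M euv -e2M mulgV (morph_one e2M).
have fM : {morph f : x y / (x * y)%g}.
  by move=> x y; rewrite -{1}(fK x) -{1}(fK y) -e2M e2K.
exists f, e2; split => //.
  (* Continuity of the inverse is checked near [1], where [commute_with_nbhs] puts all points in the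
     centralizer. *)
  apply: continuous_morphism => // U [[U1 U2] [U11 U21] UU].
  case: U11 => -[W1 W2] [/nbhs_subgP[V V1 VW] W21] WU.
  have : nbhs 1%g [set x | V x /\ (x * a = a * x /\ x * b = b * x)%g].
    apply: filterI => //; apply: filterI; first exact: commute_with_nbhs conjG nab sepG.
    by apply: (commute_with_nbhs conjG (b := a) _ sepG) => /esym.
  apply: filterS => x [Vx [xa xb]].
  have <- : e2 ((@subg G centralizer2 x (conj xa xb), false), false) = x.
    by rewrite /e2 /e1 /twist_extend /= !mulg1.
  rewrite /preimage /= e2K; apply: UU; split; last exact: (nbhs_singleton U21).
  by apply: WU; split; [exact: VW|exact: (nbhs_singleton W21)].
apply: twist_extend_continuous => //; apply: twist_extend_continuous => //.
by move=> x V xV; apply/nbhs_subgP; exists V.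
Qed.

End IsoSingular.
(** * Left invariant metrics *)

Lemma locally_compact_nbhs (T : topologicalType) (x : T) :
  locally_compact [set: T] -> exists2 C, compact C & nbhs x C.
Proof.
move=> /(_ x I)[C Cx [cC _]]; exists C => //.
have : nbhs x [set y | [set: T] y -> C y] by exact: Cx.
by apply: filterS => y; exact.
Qed.

Section MetricTopology.
Variables (R : realType) (T : topologicalType) (d : T -> T -> R).
Hypotheses (dP : is_pseudometric d) (dT : induces_topology d).

Lemma closed_metric_ball (x : T) (r : R) : closed [set y | d x y <= r].
Proof.
move=> y cly; rewrite /= leNgt; apply/negP => xy.
have [|z [/= xz yz]] := cly [set z | d y z < d x y - r].
  by rewrite dT; exists (d x y - r) => //=; rewrite subr_gt0.
by have := pseudometric_triangle dP x z y; rewrite (pseudometric_sym dP z); lra.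
Qed.

Lemma metric_ball_nbhs (x : T) (e : R) : 0 < e -> nbhs x [set y | d x y < e].
Proof. by move=> e0; rewrite dT; exists e. Qed.

Lemma nbhs_metric_ball (x : T) (U : set T) :
  nbhs x U -> exists2 e, 0 < e & forall y, d x y < e -> U y.
Proof. by rewrite dT. Qed.

End MetricTopology.

Lemma left_invariant_induces (R : realType) (G : topologicalGroupType)
    (d : G -> G -> R) : left_invariant d ->
  (forall e, 0 < e -> nbhs 1%g [set x | d 1%g x < e]) ->
  (forall U, nbhs 1%g U -> exists2 e, 0 < e & forall x, d 1%g x < e -> U x) ->
  induces_topology d.
Proof.
move=> dL dU Ud x; apply/seteqP; split=> U.
  move=> /nbhs_translate/Ud[e e0 eU]; exists e => // y /= xy.
  rewrite -(mulVKg x y); apply: eU.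
  by rewrite -(dL x) mulg1 mulVKg.
move=> [e /= e0 eU]; apply/nbhs_translate; apply: filterS (dU e e0) => y /= ey.
by apply: eU; rewrite /= -[X in d X](mulg1 x) dL.
Qed.

Section OscillationMetric.
Variables (R : realType) (G : groupType) (f : G -> R).
Hypothesis bound_f : forall x, exists C, forall g, `|f (g * x)%g - f g| <= C.

(** The sup distance between the right translates of [f] by [x] and by [y]; [bound_f] makes it a
    genuine supremum. *)
Definition osc (x y : G) : R := sup [set `|f (g * x)%g - f (g * y)%g| | g in setT].

Lemma osc_ge g x y : `|f (g * x)%g - f (g * y)%g| <= osc x y.
Proof.
apply: ub_le_sup; last by exists g.
have [C Cx] := bound_f (y^-1 * x)%g; exists C => _ [h _ <-].
by have := Cx (h * y)%g; rewrite -mulgA mulVKg.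
Qed.

Lemma osc_le x y C :
  (forall g, `|f (g * x)%g - f (g * y)%g| <= C) -> osc x y <= C.
Proof.
move=> Cg; apply: ge_sup; first by exists `|f (1 * x)%g - f (1 * y)%g|, 1%g.
by move=> _ [g _ <-].
Qed.

Lemma osc_pseudometric : is_pseudometric osc.
Proof.
split=> [x y|x|x y|x y z].
- exact: le_trans (normr_ge0 _) (osc_ge 1%g x y).
- apply/eqP; rewrite eq_le (le_trans (normr_ge0 _) (osc_ge 1%g x x)) andbT.
  by apply: osc_le => g; rewrite subrr normr0.
- by rewrite /osc; congr sup; apply: eq_imagel => g _; rewrite distrC.
- apply: osc_le => g; apply: le_trans (ler_distD (f (g * y)%g) _ _) _.
  by rewrite lerD ?osc_ge.
Qed.

Lemma osc_left_invariant : left_invariant osc.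
Proof.
move=> h x y; apply/eqP; rewrite eq_le; apply/andP; split; apply: osc_le => g.
  by rewrite !mulgA osc_ge.
by have := osc_ge (g * h^-1)%g (h * x)%g (h * y)%g; rewrite !mulgA !mulgVK.
Qed.

End OscillationMetric.

Lemma sum_pseudometric (R : realType) (T : Type) (d1 d2 : T -> T -> R) :
  is_pseudometric d1 -> is_pseudometric d2 ->
  is_pseudometric (fun x y => d1 x y + d2 x y).
Proof.
move=> p1 p2; split=> [x y|x|x y|x y z].
- by rewrite addr_ge0 ?pseudometric_ge0.
- by rewrite (pseudometric_refl p1) (pseudometric_refl p2) addr0.
- by rewrite (pseudometric_sym p1) (pseudometric_sym p2).
- by rewrite addrACA lerD ?pseudometric_triangle.
Qed.

Section LeftInvariantMetric.
Variables (R : realType) (G : topologicalGroupType).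

(** Near covering handles [g] in [C]; if only [g * y] is in [C], the same bound is applied with
    [y^-1]; otherwise both values vanish. *)
Lemma compact_support_uniform (C : set G) (f : G -> R) (e : R) :
  compact C -> (forall x, ~ C x -> f x = 0) -> 0 < e ->
  (forall x e, 0 < e -> nbhs x [set y | `|f y - f x| < e]) ->
  nbhs 1%g [set y | forall g, `|f (g * y)%g - f g| <= e].
Proof.
move=> /compact_near_coveringP cC f0 e0 fc.
have near1 : \forall y \near (1%g : G), C `<=` [set g | `|f (g * y)%g - f g| <= e].
  apply: cC => x Cx.
  have := fc x (e / 2) (divr_gt0 e0 (ltr0n R 2)).
  rewrite -{1}[x]mulg1 => /nbhs_mulg[A [B [Ax B1 AB]]].
  exists (A `&` [set y | `|f y - f x| < e / 2], B).
    by split=> //=; apply: filterI => //; apply: fc; rewrite divr_gt0.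
  move=> [g y] [/= [Ag gx] By].
  apply: le_trans (ler_distD (f x) _ _) _.
  have := AB _ _ Ag By => /= h; rewrite [`|f x - _|]distrC; lra.
have nearV : nbhs 1%g [set y | C `<=` [set g | `|f (g * y^-1)%g - f g| <= e]].
  apply: (@invg_continuous G 1%g [set y | C `<=` [set g | `|f (g * y)%g - f g| <= e]]).
  by rewrite invg1.
apply: filterS2 near1 nearV => y /= Cy CyV g.
have [Cg|Cg] := pselect (C g); first exact: Cy.
have [Cgy|Cgy] := pselect (C (g * y)%g).
  by have := CyV _ Cgy; rewrite /= mulgK distrC.
by rewrite !f0 // subrr normr0 ltW.
Qed.

(** The metric is [osc f] for a bump [f] at [1] supported in [C]. Uniform continuity makes it small
    near [1]; conversely it is at least [1 - f x], which controls [rho 1 x]. *)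
Lemma exists_left_invariant_metric (rho : G -> G -> R) (C : set G) :
  is_metric rho -> induces_topology rho -> compact C -> nbhs 1%g C ->
  exists d : G -> G -> R,
    [/\ is_metric d, induces_topology d & left_invariant d].
Proof.
move=> [rP r0] rT cC C1.
have [r rpos rC] := nbhs_metric_ball rT C1.
pose f x := Num.max 0 (1 - rho 1%g x / r).
have f0 x : ~ C x -> f x = 0.
  move=> Cx; apply/max_idPl; rewrite subr_le0 ler_pdivlMr // mul1r leNgt.
  by apply/negP => /rC.
have f01 x : 0 <= f x <= 1.
  have h0 : 0 <= rho 1%g x / r by rewrite divr_ge0 ?(pseudometric_ge0 rP) // ltW.
  by rewrite /f le_max lexx ge_max ler01 lerBlDr lerDl h0.
have fL x y : `|f y - f x| <= rho x y / r.
  have h1 : rho 1%g y / r <= rho 1%g x / r + rho x y / r.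
    by rewrite -mulrDl ler_pM2r ?invr_gt0 // pseudometric_triangle.
  have h2 : rho 1%g x / r <= rho 1%g y / r + rho x y / r.
    by rewrite -mulrDl ler_pM2r ?invr_gt0 // (pseudometric_sym rP x) pseudometric_triangle.
  have h3 : 0 <= rho x y / r by rewrite divr_ge0 ?(pseudometric_ge0 rP) // ltW.
  rewrite /f; move: h1 h2 h3; move: (rho _ y / r) (rho _ x / r) (rho x y / r) => u v t.
  move=> h1 h2 h3; rewrite ler_norml.
  case: (leP 0 (1 - u)) => hu; case: (leP 0 (1 - v)) => hv; apply/andP; split; lra.
have fc x e : 0 < e -> nbhs x [set y | `|f y - f x| < e].
  move=> e0; have : nbhs x [set y | rho x y < e * r].
    by apply: (metric_ball_nbhs rT); rewrite mulr_gt0.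
  by apply: filterS => y /= xy; apply: le_lt_trans (fL x y) _; rewrite ltr_pdivrMr.
have bf x : exists C, forall g, `|f (g * x)%g - f g| <= C.
  exists 1 => g; have := f01 g; have := f01 (g * x)%g.
  by move=> /andP[? ?] /andP[? ?]; rewrite ler_norml; apply/andP; split; lra.
have f1 : f 1%g = 1.
  by rewrite /f pseudometric_refl // mul0r subr0; apply/max_idPr.
have fsmall x e : osc f 1%g x < Num.min 1 (e / r) -> rho 1%g x < e.
  have := osc_ge bf 1%g 1%g x; rewrite !mul1g f1 lt_min => le1 /andP[h1 h2].
  have : 1 - f x <= `|1 - f x| by exact: ler_norm.
  rewrite /f in le1 *; rewrite -(ltr_pM2r (x := r^-1)) ?invr_gt0 //.
  case: (leP 0 (1 - rho 1%g x / r)) le1 => ? ?; lra.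
exists (osc f); split; last exact: osc_left_invariant.
  split; first exact: osc_pseudometric.
  move=> x y xy; have : osc f 1%g (x^-1 * y)%g = 0.
    by rewrite -(mulVg x) osc_left_invariant.
  move=> e0; have : rho 1%g (x^-1 * y)%g = 0.
    apply/eqP; rewrite eq_le (pseudometric_ge0 rP) andbT leNgt; apply/negP => h.
    have := @fsmall (x^-1 * y)%g (rho 1%g (x^-1 * y)%g).
    by rewrite e0 lt_min ltr01 divr_gt0 // ltxx => /(_ isT).
  by move=> /r0 e; rewrite -[y](mulVKg x) -e mulg1.
apply: left_invariant_induces; first exact: osc_left_invariant.
  move=> e e0; have := compact_support_uniform cC f0 (divr_gt0 e0 (ltr0n R 2)) fc.
  apply: filterS => y /= fy; apply: le_lt_trans (_ : e / 2 < e); last lra.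
  by apply: osc_le => g; rewrite mulg1 distrC.
move=> U /(nbhs_metric_ball rT)[e e0 eU]; exists (Num.min 1 (e / r)).
  by rewrite lt_min ltr01 divr_gt0.
by move=> x /fsmall/eU.
Qed.

(** [L x] is the first [n] with [x] in the compact symmetric set [D n]. Each step adjoins [h n] and
    its inverse before taking products, so that the [D n] exhaust the group. *)
Lemma exhaustion (d : G -> G -> R) (h : nat -> G) (r : R) :
  is_pseudometric d -> left_invariant d -> 0 < r ->
  compact [set x | d 1%g x <= r] ->
  (forall x, exists n, d (h n) x <= r) ->
  exists L : G -> nat, [/\ forall n, compact [set x | (L x <= n)%N],
    forall x, (L x == 0%N) = (d 1%g x <= r), forall x, L x^-1%g = L x &
    forall x y, (L (x * y)%g <= (maxn (L x) (L y)).+1)%N].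
Proof.
move=> dP dL r0 cD hd.
pose E (A : set G) n := A `|` [set h n] `|` [set (h n)^-1%g].
pose D := fix D n : set G := if n is n'.+1 then
  [set z | exists x y, [/\ E (D n') n' x, E (D n') n' y & z = (x * y)%g]]
  else [set x | d 1%g x <= r].
have cDn n : compact (D n).
  elim: n => //= n IH; apply: compact_mulg;
    by apply: compactU; [apply: compactU => //|]; exact: compact_set1.
have D1 n : D n 1%g.
  elim: n => [|n IH] /=; first by rewrite pseudometric_refl // ltW.
  by exists 1%g, 1%g; split; rewrite ?mulg1 //; left; left.
have DM n x y : D n x -> D n y -> D n.+1 (x * y)%g.
  by move=> Dx Dy; exists x, y; split => //; left; left.
have DS n x : D n x -> D n.+1 x by move=> Dx; rewrite -[x]mulg1; exact: DM.
have Dle m n x : (m <= n)%N -> D m x -> D n x.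
  by move=> /subnK <-; elim: (n - m)%N => // k IH Dx; rewrite addSn; apply: DS; exact: IH.
have DV n x : D n x -> D n x^-1%g.
  elim: n x => [|n IH] x; first by rewrite /= inv_distV.
  have EV z : E (D n) n z -> E (D n) n z^-1%g.
    by move=> [[/IH|->]|->]; [left; left|right|rewrite invgK; left; right].
  by move=> [y [z [Ey Ez ->]]]; rewrite invgM; exists z^-1%g, y^-1%g; split => //; exact: EV.
have Dex x : exists n, `[< D n x >].
  have [n hx] := hd x; exists n.+2; apply/asboolP.
  rewrite -(mulVKg (h n) x); apply: DM.
    by exists (h n), 1%g; split; [left; right|left; left|rewrite mulg1].
  by apply: (@Dle 0%N) => //=; rewrite -(mulVg (h n)) dL.
pose L x := ex_minn (Dex x).
have LP x n : (L x <= n)%N <-> D n x.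
  rewrite /L; case: ex_minnP => m /asboolP Dm mmin; split=> [mn|Dn].
    exact: Dle Dm.
  by apply: mmin; apply/asboolP.
exists L; split.
- move=> n; rewrite (_ : mkset _ = D n) //.
  by apply/seteqP; split=> x; [move=> /= /LP|move=> Dx; apply/LP].
- move=> x; rewrite -leqn0; apply/idP/idP; first by move=> /LP.
  by move=> Dx; apply/LP.
- move=> x; apply/eqP; rewrite eqn_leq; apply/andP; split; apply/LP.
    by apply: DV; apply/LP.
  by rewrite -[X in D _ X]invgK; apply: DV; apply/LP.
- move=> x y; apply/LP; apply: DM; apply/LP; [exact: leq_maxl|exact: leq_maxr].
Qed.

End LeftInvariantMetric.

(** * Proper left invariant metrics and the conjugacy condition *)

Section ProperMetric.
Variables (R : realType) (G : topologicalGroupType).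

(** A local Lipschitz bound on [f] gives [osc f <= K * d] at short distances, so the topology does
    not change. *)
Lemma add_osc_Metr_c (d : G -> G -> R) (f : G -> R) :
  is_metric d -> induces_topology d -> left_invariant d ->
  (forall x, exists C, forall g, `|f (g * x)%g - f g| <= C) ->
  (exists K e, [/\ 0 <= K, 0 < e &
     forall x y, d x y < e -> `|f x - f y| <= K * d x y]) ->
  [/\ is_metric (fun x y => d x y + osc f x y),
      induces_topology (fun x y => d x y + osc f x y) &
      left_invariant (fun x y => d x y + osc f x y)].
Proof.
move=> [dP d0] dT dL bf [K [e [K0 e0 fK]]].
have oP := osc_pseudometric bf; have oL := osc_left_invariant bf.
have sL : left_invariant (fun x y => d x y + osc f x y).
  by move=> g x y; rewrite dL oL.
split => //.
  split; first exact: sum_pseudometric.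
  move=> x y; have := pseudometric_ge0 dP x y; have := pseudometric_ge0 oP x y.
  by move=> h1 h2 h3; apply: d0; lra.
apply: left_invariant_induces => // [t t0|U /(nbhs_metric_ball dT)[t t0 tU]].
  have K1 : 0 < 1 + K by rewrite ltr_wpDr.
  have : nbhs 1%g [set x | d 1%g x < Num.min e (t / (1 + K))].
    by apply: (metric_ball_nbhs dT); rewrite lt_min e0 divr_gt0.
  apply: filterS => x /=; rewrite lt_min ltr_pdivlMr // => /andP[xe xt].
  suff : osc f 1%g x <= K * d 1%g x by lra.
  by apply: osc_le => g; rewrite -(dL g); apply: fK; rewrite dL.
exists t => // x xt; apply: tU; have := pseudometric_ge0 oP 1%g x; lra.
Qed.

(** The integer-valued [L] is smoothed into a locally Lipschitz [F] with [L - 1 <= F <= L]. After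
    adding [osc F], the index [L] is bounded on each ball around [1], which therefore lies in a
    compact set. *)
Lemma exists_proper_metric (d : G -> G -> R) (h : nat -> G) (C : set G) :
  is_metric d -> induces_topology d -> left_invariant d ->
  compact C -> nbhs 1%g C ->
  (forall (x : G) (U : set G), nbhs x U -> exists n, U (h n)) ->
  exists2 d' : G -> G -> R, Metr_c R G d' & left_invariant d'.
Proof.
move=> dM dT dL cC C1 hd; have [dP d0] := dM.
have [s s0 sC] := nbhs_metric_ball dT C1; pose r := s / 4.
have r0 : 0 < r by rewrite divr_gt0.
have r20 : 0 < 2 * r by rewrite mulr_gt0.
have [||L [cL L0 LV LM]] := @exhaustion R G d h (2 * r) dP dL r20.
- apply: (subclosed_compact _ cC); first exact: closed_metric_ball.
  by move=> x /= x2r; apply: sC; rewrite /r in x2r; lra.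
- move=> x; have [n xn] := hd x _ (metric_ball_nbhs dT x r20).
  by exists n; rewrite (pseudometric_sym dP) ltW.
have Lnear x y : d x y <= 2 * r -> (L x <= (L y).+1)%N.
  rewrite (pseudometric_sym dP) inv_distE // -L0 => /eqP L1.
  by have := LM y (y^-1 * x)%g; rewrite mulVKg L1 maxn0.
have dge0 x y : 0 <= d x y by exact: pseudometric_ge0.
(* The constraint d x y <= 2 * r is invisible: by Lnear, a y with d x y >= r costs
   at least as much as y = x.  This makes F locally Lipschitz. *)
pose A x := [set (L y)%:R + d x y / r | y in [set y | d x y <= 2 * r]].
pose F x := inf (A x).
have Alb x z : A x z -> (L x)%:R - 1 <= z.
  move=> [y /Lnear Lxy <-]; have : 0 <= d x y / r by rewrite divr_ge0 // ltW.
  have : (L x)%:R <= (L y).+1%:R :> R by rewrite ler_nat.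
  by rewrite -natr1; lra.
have Fle x y : d x y <= 2 * r -> F x <= (L y)%:R + d x y / r.
  by move=> xy; apply: ge_inf; [exists ((L x)%:R - 1) => z /Alb|exists y].
have Axx x : A x (L x)%:R.
  exists x => /=; first by rewrite pseudometric_refl // ltW.
  by rewrite pseudometric_refl // mul0r addr0.
have FleL x : F x <= (L x)%:R.
  by apply: ge_inf => //; exists ((L x)%:R - 1) => z /Alb.
have FgeL x : (L x)%:R - 1 <= F x.
  by apply: lb_le_inf; [exists (L x)%:R|move=> z /Alb].
have Flip x x' : d x x' < r -> F x' <= F x + d x x' / r.
  move=> xx'; rewrite -lerBlDr; apply: lb_le_inf; first by exists (L x)%:R.
  move=> _ [y /= xy <-]; rewrite lerBlDr.
  have tri : d x' y / r <= d x y / r + d x x' / r.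
    rewrite -mulrDl ler_pM2r ?invr_gt0 // addrC (pseudometric_sym dP x).
    exact: pseudometric_triangle.
  have [xyr|xyr] := leP (d x y) r.
    apply: le_trans (Fle x' y _) _; last by lra.
    have := pseudometric_triangle dP x' x y; rewrite (pseudometric_sym dP x' x); lra.
  apply: le_trans (Fle x' x _) _; first by rewrite (pseudometric_sym dP); lra.
  rewrite (pseudometric_sym dP x') lerD2r.
  have : 1 <= d x y / r by rewrite ler_pdivlMr // mul1r ltW.
  have : (L x)%:R <= (L y).+1%:R :> R by rewrite ler_nat Lnear.
  by rewrite -natr1; lra.
have bF x : exists C, forall g, `|F (g * x)%g - F g| <= C.
  (* One unit comes from [LM], the other from the gap between [F] and [L]. *)
  exists ((L x)%:R + 2) => g.
  have LD u v : (L (u * v)%g)%:R <= (L u)%:R + (L v)%:R + 1 :> R.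
    rewrite -natrD natr1 ler_nat; apply: leq_trans (LM u v) _.
    by rewrite ltnS geq_max leq_addr leq_addl.
  have := LD g x; have := LD (g * x)%g x^-1%g; rewrite mulgK LV.
  have := FleL g; have := FgeL g; have := FleL (g * x)%g; have := FgeL (g * x)%g.
  by move=> *; rewrite ler_norml; apply/andP; split; lra.
have [|oM oT oL] := add_osc_Metr_c dM dT dL bF.
  exists r^-1, r; split=> [||x y xy] //; first by rewrite invr_ge0 ltW.
  have h1 := Flip x y xy; have h2 := Flip y x; rewrite (pseudometric_sym dP) in h2.
  by have {}h2 := h2 xy; rewrite mulrC ler_norml; apply/andP; split; lra.
exists (fun x y => d x y + osc F x y) => //; split => // x t.
have := @compact_translate _ x^-1%g _ (cL (Num.truncn (t + (L 1%g)%:R + 1)).+1).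
move=> cLx; apply: (subclosed_compact _ cLx).
  by apply: (closed_metric_ball _ oT); case: oM.
move=> y /= xyt.
have : F (x^-1 * y)%g - F 1%g <= t.
  apply: le_trans (ler_norm _) _; rewrite distrC -(mulVg x).
  apply: le_trans (osc_ge bF _ _ _) _; apply: le_trans xyt.
  by rewrite lerDr.
move=> Ft; rewrite -(ler_nat R); apply: ltW.
apply: le_lt_trans (truncnS_gt _).
have := FgeL (x^-1 * y)%g; have := FleL 1%g; lra.
Qed.

(** Right invariance of [d] and of [d + osc f] gives [osc f 1 x = osc f 1 x']. For the bump at [1]
    minus the bump at [x], the first is at least 2 and the second at most 1. *)
Lemma conjugates_trivial_of_Metr_c (d : G -> G -> R) :
  Metr_c R G d -> left_invariant d ->
  (forall d' : G -> G -> R,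
     Metr_c R G d' -> left_invariant d' -> right_invariant d') ->
  conjugates_trivial G.
Proof.
move=> [dM dT dC] dL rinv x g; have [dP d0] := dM.
apply: contrapT => /not_orP[nc1 nc2].
pose x' := (g^-1 * (x * g))%g.
have x'x : x <> x' by move=> e; apply: nc1; rewrite {2}e mulVKg.
have x'V : x^-1%g <> x' by move=> e; apply: nc2; rewrite e mulVKg.
have x1 : x <> 1%g by move=> e; apply: nc1; rewrite e mul1g mulg1.
have pos u v : u <> v -> 0 < d u v.
  move=> uv; rewrite lt_neqAle (pseudometric_ge0 dP) andbT eq_sym.
  by apply: contra_not_neq uv => /d0.
have posV : 0 < d x^-1%g x' / 2 by rewrite divr_gt0 // pos.
have posx : 0 < d x x' / 2 by rewrite divr_gt0 // pos.
have [e1 e10 e1P] : exists2 e, 0 < e &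
    forall z, d x z < e -> d x^-1%g z^-1%g < d x^-1%g x' / 2.
  apply: (nbhs_metric_ball dT (U := [set z | d x^-1%g z^-1%g < d x^-1%g x' / 2])).
  by apply: (@invg_continuous G x [set z | d x^-1%g z < d x^-1%g x' / 2]);
    exact: metric_ball_nbhs.
have [e2 e20 e2P] : exists2 e, 0 < e &
    forall z, d 1%g z < e -> d x (z^-1 * x)%g < d x x' / 2.
  apply: (nbhs_metric_ball dT (U := [set z | d x (z^-1 * x)%g < d x x' / 2])).
  apply: (@invg_continuous G 1%g [set z | d x (z * x)%g < d x x' / 2]).
  apply: (@mulg_continuous_right G x _ [set z | d x z < d x x' / 2]).
  by rewrite invg1 mul1g; exact: metric_ball_nbhs.
(* The bumps at [1] and [x] vanish at each other's centre; [e1] and [e2], with the half distances,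
   keep [x'] out of reach from [x^-1] and [x]. *)
pose e := Num.min (d 1%g x) (Num.min (Num.min e1 e2)
  (Num.min (d x^-1%g x' / 2) (d x x' / 2))).
have e0 : 0 < e by rewrite !lt_min pos ?e10 ?e20 ?posV ?posx // => /esym.
have [ex ee1 ee2 eV exx] : [/\ e <= d 1%g x, e <= e1, e <= e2,
    e <= d x^-1%g x' / 2 & e <= d x x' / 2].
  by split; rewrite !ge_min lexx ?orbT.
pose b u y := Num.max 0 (1 - d u y / e).
have b01 u y : 0 <= b u y <= 1.
  have h0 : 0 <= d u y / e by rewrite divr_ge0 ?(pseudometric_ge0 dP) // ltW.
  by rewrite /b le_max lexx ge_max ler01 lerBlDr lerDl h0.
have bpos u y : 0 < b u y -> d u y < e.
  by rewrite lt_max ltxx /= subr_gt0 ltr_pdivrMr // mul1r.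
have bL u y z : `|b u y - b u z| <= d y z / e.
  have h1 : d u y / e <= d u z / e + d y z / e.
    rewrite -mulrDl ler_pM2r ?invr_gt0 // (pseudometric_sym dP y).
    exact: pseudometric_triangle.
  have h2 : d u z / e <= d u y / e + d y z / e.
    by rewrite -mulrDl ler_pM2r ?invr_gt0 // pseudometric_triangle.
  have h3 : 0 <= d y z / e by rewrite divr_ge0 ?(pseudometric_ge0 dP) // ltW.
  rewrite /b; move: h1 h2 h3; move: (d u y / e) (d u z / e) (d y z / e) => p q t.
  move=> h1 h2 h3; rewrite ler_norml.
  case: (leP 0 (1 - p)) => hp; case: (leP 0 (1 - q)) => hq; apply/andP; split; lra.
pose f y := b 1%g y - b x y.
have bf z : exists C, forall h, `|f (h * z)%g - f h| <= C.
  exists 2 => h; rewrite /f; have := b01 1%g (h * z)%g; have := b01 1%g h.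
  have := b01 x (h * z)%g; have := b01 x h.
  by move=> /andP[? ?] /andP[? ?] /andP[? ?] /andP[? ?];
    rewrite ler_norml; apply/andP; split; lra.
have [|oM oT oL] := add_osc_Metr_c dM dT dL bf.
  exists (2 / e), 1; split => // [|y z _]; first by rewrite divr_ge0 // ltW.
  have := bL 1%g y z; have := bL x y z; rewrite !ler_norml /f.
  have -> : 2 / e * d y z = d y z / e + d y z / e by field; rewrite gt_eqF.
  by move=> /andP[? ?] /andP[? ?]; apply/andP; split; lra.
have oC : proper_metric (fun y z => d y z + osc f y z).
  move=> y t; apply: (subclosed_compact _ (dC y t)).
    by apply: (closed_metric_ball _ oT); case: oM.
  move=> z /=; have := pseudometric_ge0 (osc_pseudometric bf) y z; lra.
have conj_eq d' : left_invariant d' -> right_invariant d' -> d' 1%g x = d' 1%g x' :> R.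
  by move=> l r; rewrite /x' -(r g) mul1g -[LHS](l g^-1%g) mulVg.
have := conj_eq _ oL (rinv _ (And3 oM oT oC) oL).
rewrite (conj_eq _ dL (rinv _ (And3 dM dT dC) dL)) => /addrI osc_eq.
have : 2 <= osc f 1%g x.
  apply: le_trans (osc_ge bf 1%g 1%g x); rewrite !mul1g /f.
  have bb u : b u u = 1.
    by rewrite /b (pseudometric_refl dP) mul0r subr0; apply/max_idPr.
  have b0 u v : e <= d u v -> b u v = 0.
    by move=> uv; apply/max_idPl; rewrite subr_le0 ler_pdivlMr // mul1r.
  rewrite !bb (b0 1%g x) // (b0 x 1%g) ?(pseudometric_sym dP x) //.
  by apply: le_trans (ler_norm _); lra.
rewrite osc_eq leNgt => /negP; apply; apply: le_lt_trans (_ : 1 < 2); last lra.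
apply: osc_le => h; rewrite mulg1 leNgt; apply/negP => h1.
(* A difference above 1 needs [h] and [h * x'] in opposite bumps. With [h] near [1], [x'] would be
   near [x]; with [h] near [x], it would be near [x^-1]. *)
have B1 : ~ (d 1%g h < e /\ d x (h * x')%g < e).
  move=> [h2 h3]; have := e2P h (lt_le_trans h2 ee2).
  have := pseudometric_triangle dP x (h^-1 * x)%g x'.
  by rewrite -(dL h (h^-1 * x)%g) mulVKg; lra.
have B2 : ~ (d 1%g (h * x')%g < e /\ d x h < e).
  move=> [h2 h3]; have := e1P h (lt_le_trans h3 ee1).
  have := pseudometric_triangle dP x^-1%g h^-1%g x'.
  by rewrite -(dL h h^-1%g) mulgV; lra.
move: h1; rewrite /f; have := b01 1%g (h * x')%g; have := b01 1%g h.
have := b01 x (h * x')%g; have := b01 x h.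
move=> /andP[? ?] /andP[? ?] /andP[? ?] /andP[? ?].
rewrite ltr_normr => /orP[h4|h4].
  by apply: B1; split; apply: bpos; lra.
by apply: B2; split; apply: bpos; lra.
Qed.

End ProperMetric.

(** * Iso-singular groups *)

Section TwistConjugates.
Local Open Scope group_scope.

(** An element of trivial sign is fixed or inverted by conjugation. One of nontrivial sign has
    inverse [(x * p, true)], and its conjugates differ from it at most by [p], since squares in [T]
    are 1 or [p]. *)
Lemma conjugates_trivial_twist (T : basePair) :
  (forall x : T, x * x = 1 \/ x * x = base_point T) ->
  conjugates_trivial (twist T).
Proof.
move=> sqT.
have pp : base_point T * base_point T = 1 by rewrite -expg2 base_point_sq.
have pV : (base_point T)^-1 = base_point T by rewrite -[LHS]mulg1 -pp mulKg.
have TC := @base_abelian T.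
have inv x : x^-1 = x \/ x^-1 = x * base_point T.
  have [xx|xx] := sqT x; [left|right].
    by rewrite -[LHS]mulg1 -xx mulKg.
  by apply: (@mulgI _ x); rewrite mulgV mulgA xx pp.
have VE (u : twist T) : u^-1 = twist_inv u by [].
move=> [x j] [y k]; rewrite VE !twistE /twist_inv.
case: j k => [] [] /=.
- rewrite invgM pV; have -> : y * (base_point T * x^-1) * base_point T = y * x^-1.
    by rewrite -!mulgA (TC x^-1) (mulgA (base_point T)) pp mul1g.
  have [->|->] := inv x; have [->|->] := inv y.
  + by left; rewrite (TC x).
  + by right; rewrite -!mulgA pp mulg1 TC.
  + by right; rewrite mulgA (TC x).
  + by left; rewrite !mulgA (TC x).
- have [->|->] := inv y; [left|right]; first by rewrite TC.
  by rewrite !mulgA (TC x).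
- right; by rewrite invgK TC.
- by left; rewrite TC.
Qed.

Lemma conjugates_trivial_iso (G H : topologicalGroupType) :
  topgroup_isomorphic G H -> conjugates_trivial H -> conjugates_trivial G.
Proof.
move=> [f [g [fM fK _ _ _]]] conjH x y.
have [e|e] := conjH (f x) (f y); [left|right]; apply: (can_inj fK).
  by rewrite !fM.
by rewrite !fM (morph_inv fM).
Qed.

Lemma iso_singular_conjugates (G : topologicalGroupType) :
  iso_singular G -> conjugates_trivial G.
Proof.
move=> [B [bB iso]]; apply: (conjugates_trivial_iso iso).
apply: conjugates_trivial_twist => -[x j]; rewrite /= twistE /twist_point.
have bx : x * x = 1 by rewrite boolean_mulgg.
case: j => /=; [right|left]; last by rewrite bx.
by rewrite (boolean_invg bB) bx mul1g.
Qed.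

Lemma conjugates_trivial_right_invariant (R : realType) (G : groupType)
    (d : G -> G -> R) : conjugates_trivial G ->
  is_pseudometric d -> left_invariant d -> right_invariant d.
Proof.
move=> conjG dP dL g x y.
rewrite -(dL x^-1 x) -(dL (x * g)^-1) !mulVg invgM.
have -> : g^-1 * x^-1 * (y * g) = g^-1 * (x^-1 * y * g) by rewrite !mulgA.
case: (conjG (x^-1 * y) g) => ->; rewrite mulKg //.
by rewrite -[LHS](dL (x^-1 * y)) mulg1 mulgV (pseudometric_sym dP).
Qed.

End TwistConjugates.

Lemma topgroup_isomorphic_trans (G H K : topologicalGroupType) :
  topgroup_isomorphic G H -> topgroup_isomorphic H K -> topgroup_isomorphic G K.
Proof.
move=> [f [f' [fM fK f'K fc f'c]]] [g [g' [gM gK g'K gc g'c]]].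
exists (g \o f), (f' \o g'); split.
- by move=> x y /=; rewrite fM gM.
- exact: can_comp.
- exact: can_comp.
- by move=> x; apply: continuous_comp; [exact: fc|exact: gc].
- by move=> x; apply: continuous_comp; [exact: g'c|exact: f'c].
Qed.

Definition basePair_iso (B B' : basePair) (phi : B -> B') (psi : B' -> B) :=
  [/\ {morph phi : x y / (x * y)%g}, cancel phi psi, cancel psi phi,
      continuous phi & continuous psi] /\ phi (base_point B) = base_point B'.

Lemma twist_map_continuous (B B' : basePair) (phi : B -> B') :
  continuous phi -> continuous (fun u : twist B => (phi u.1, u.2) : twist B').
Proof.
move=> phic u.
have c1 : {for u, continuous (fun u : twist B => phi u.1)}.
  by apply: (@continuous_comp _ _ _ fst phi); [exact: cvg_fst|exact: phic].
have c2 : {for u, continuous (fun u : twist B => u.2)} by exact: cvg_snd.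
exact: cvg_pair c1 c2.
Qed.

Lemma basePair_iso_twist (B B' : basePair) (phi : B -> B') (psi : B' -> B) :
  basePair_iso phi psi ->
  let Phi (u : twist B) : twist B' := (phi u.1, u.2) in
  let Psi (u : twist B') : twist B := (psi u.1, u.2) in
  [/\ {morph Phi : x y / (x * y)%g}, cancel Phi Psi, cancel Psi Phi,
      continuous Phi & continuous Psi].
Proof.
move=> [[phiM phiK psiK phic psic] phip] Phi Psi; split.
- move=> [x []] [y k]; rewrite !twistE /Phi /=; last by rewrite phiM.
  by case: k; rewrite /= !phiM (morph_inv phiM) ?phip.
- by move=> [x j]; rewrite /Phi /Psi /= phiK.
- by move=> [x j]; rewrite /Phi /Psi /= psiK.
- exact: twist_map_continuous.
- exact: twist_map_continuous.
Qed.

Lemma twist_twist_iso (B B' : basePair) (bB : boolean_group B)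
    (bB' : boolean_group B') (phi : B -> B') (psi : B' -> B) :
  basePair_iso phi psi ->
  topgroup_isomorphic (twist (twist_basePair bB)) (twist (twist_basePair bB')).
Proof.
move=> iso; have iso1 := basePair_iso_twist iso.
have iso2 : @basePair_iso (twist_basePair bB) (twist_basePair bB')
    (fun u => (phi u.1, u.2)) (fun u => (psi u.1, u.2)).
  by split=> //=; case: iso => _; rewrite /twist_point /= => ->.
have [M K K' c c'] := basePair_iso_twist iso2.
by do 2 eexists; split; [exact: M|exact: K|exact: K'|exact: c|exact: c'].
Qed.

Lemma separable_sequence (T : topologicalType) (x0 : T) : separable T ->
  exists h : nat -> T, forall (x : T) (U : set T), nbhs x U -> exists n, U (h n).
Proof.
move=> [D /countable_injP[c] cinj dD].
have /choice[h hP] : forall n, exists y, forall x, D x -> c x = n -> y = x.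
  move=> n; have [[x [Dx cx]]|nx] := pselect (exists x, D x /\ c x = n).
    exists x => y Dy cy; apply: cinj; rewrite ?inE //.
    by rewrite cx cy.
  by exists x0 => x Dx cx; exfalso; apply: nx; exists x.
exists h => x U; rewrite nbhsE => -[O [oO Ox] OU].
have [|y [Oy Dy]] := dD O _ oO; first by exists x.
by exists (c y); rewrite (hP (c y) y Dy erefl); exact: OU.
Qed.

Lemma Metr_c_conjugates_trivial (R : realType) (G : topologicalGroupType) :
  locally_compact [set: G] -> polish R G ->
  (forall d : G -> G -> R,
     Metr_c R G d -> left_invariant d -> right_invariant d) ->
  conjugates_trivial G.
Proof.
move=> lcG [sG [rho [rhoM rhoT _]]] rinv.
have [C cC C1] := locally_compact_nbhs 1%g lcG.
have [h hd] := separable_sequence 1%g sG.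
have [d [dM dT dL]] := exists_left_invariant_metric rhoM rhoT cC C1.
have [d' d'C d'L] := exists_proper_metric dM dT dL cC C1 hd.
exact: conjugates_trivial_of_Metr_c d'C d'L rinv.
Qed.

Lemma conjugates_trivial_iso_singular (R : realType) (G : topologicalGroupType) :
  polish R G -> conjugates_trivial G -> abelian_group G \/ iso_singular G.
Proof.
move=> [_ [rho [[rP r0] rT _]]] conjG.
have [ab|/existsNP[a /existsNP[b nab]]] := pselect (abelian_group G); first by left.
right; apply: (iso_singular_noncomm conjG nab) => x y xy.
have xy0 : 0 < rho x y.
  rewrite lt_neqAle (pseudometric_ge0 rP) andbT eq_sym.
  by apply: contra_not_neq xy => /r0.
exists [set z | rho x z < rho x y]; first exact: metric_ball_nbhs.
by rewrite /= ltxx.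
Qed.

(** * Countability of the iso-singular groups up to isomorphism *)

Lemma iso_singular_coordinates (R : realType) (G : topologicalGroupType)
    (B : basePair) (bB : boolean_group B) :
  locally_compact [set: G] -> polish R G ->
  topgroup_isomorphic G (twist (twist_basePair bB)) ->
  exists S T c chi f, coordinates S T (base_point B) c chi f.
Proof.
move=> lcG [sG [rho [rhoM rhoT _]]] [f [g [fM fK gK fc gc]]].
have [C cC C1] := locally_compact_nbhs 1%g lcG.
have [h hd] := separable_sequence 1%g sG.
have [d [dM dT dL]] := exists_left_invariant_metric rhoM rhoT cC C1.
(* The metric, the compact neighbourhood and the dense sequence pass from [G] to [B] through the
   continuous morphism [iota] and its continuous left inverse [pi], which is itself not a
   morphism. *)
pose pi (x : G) : B := (f x).1.1.
pose iota (x : B) : G := g ((x, false), false).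
have pic : continuous pi.
  move=> x; apply: (@continuous_comp _ _ _ f
    (fun u : twist (twist_basePair bB) => u.1.1)); first exact: fc.
  by apply: (@continuous_comp _ _ _ fst fst); exact: cvg_fst.
have iotac : continuous iota.
  move=> x; apply: (@continuous_comp _ _ _ (fun x : B => ((x, false), false) :
    twist (twist_basePair bB)) g); last exact: gc.
  exact: cvg_pair (cvg_pair cvg_id (cvg_cst false)) (cvg_cst false).
have iotaK : cancel iota pi by move=> x; rewrite /iota /pi gK.
have gM : {morph g : x y / (x * y)%g}.
  by move=> x y; rewrite -{1}(gK x) -{1}(gK y) -fM fK.
have iotaM : {morph iota : x y / (x * y)%g} by move=> x y; rewrite /iota -gM.
have iota1 := morph_one iotaM.
pose dB (x y : B) := d (iota x) (iota y).
have [dP d0] := dM.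
apply: (@exists_coordinates R B dB _ bB _ _ _ _ (pi \o h) (base_point B) (pi @` C)).
- exact: base_abelian.
- split=> [x y|x|x y|x y z].
  + exact: (pseudometric_ge0 dP).
  + exact: (pseudometric_refl dP).
  + exact: (pseudometric_sym dP).
  + exact: (pseudometric_triangle dP).
- by move=> x y z; rewrite /dB !iotaM dL.
- move=> x; apply/seteqP; split=> U.
    move=> xU; have : nbhs (iota x) (pi @^-1` U) by apply: pic; rewrite iotaK.
    move=> /(nbhs_metric_ball dT)[e e0 eU]; exists e => // y /= xy.
    by rewrite -(iotaK y); exact: eU.
  move=> [e /= e0 eU]; apply: filterS eU _.
  exact: (iotac x [set y | d (iota x) y < e] (metric_ball_nbhs dT _ e0)).
- by move=> x y /d0 e; rewrite -(iotaK x) e iotaK.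
- move=> x U U1; have : nbhs (iota x^-1%g) (pi @^-1` [set y | U (y * x)%g]).
    apply: pic; rewrite iotaK.
    by apply: (@mulg_continuous_right B x x^-1%g U); rewrite mulVg.
  by move=> /hd[n]; exists n.
- exact: base_point_neq1.
- apply: continuous_compact => //; exact: continuous_subspaceT.
- have : nbhs 1%g (iota @^-1` C) by apply: iotac; rewrite iota1.
  by apply: filterS => x Cx; exists (iota x).
Qed.

(* The value of the enumeration at indices that no Boolean group realizes. *)
Definition sign_group : Type := bool.

HB.instance Definition _ := Topological.copy sign_group bool.

HB.instance Definition _ := isGroup.Build sign_group
  addbA addFb addbF addbb addbb.

Lemma sign_group_mul_continuous :
  continuous (fun u : sign_group * sign_group => (u.1 * u.2)%g).
Proof.
move=> [x y] U /principal_filterP Uxy; exists ([set x], [set y]).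
  by split; exact/principal_filterP.
by move=> [_ _] [/= -> ->].
Qed.

Lemma sign_group_inv_continuous : continuous (fun x : sign_group => x^-1)%g.
Proof. by move=> x; exact: cvg_id. Qed.

HB.instance Definition _ := isTopologicalGroup.Build sign_group
  sign_group_mul_continuous sign_group_inv_continuous.

(** Countable cardinals are encoded in [option nat] so that [pickle] can number pairs of them. *)
Definition cardinal_nat (c : option nat) : set nat :=
  if c is Some n then `I_n else setT.

Lemma cardinal_natP (S : set nat) : exists c, (S #= cardinal_nat c)%card.
Proof.
have [[n Sn]|inf] := pselect (finite_set S); first by exists (Some n).
by exists None; exact: eq_card_nat.
Qed.

Definition coordinate_type (n : nat) (B : basePair) :=
  exists a b S T c chi f, [/\ unpickle n = Some (a, b),
    (S #= cardinal_nat a)%card, (T #= cardinal_nat b)%card &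
    coordinates S T (base_point B) c chi f].

Lemma coordinate_type_iso n (B B' : basePair) (bB : boolean_group B)
    (bB' : boolean_group B') : coordinate_type n B -> coordinate_type n B' ->
  topgroup_isomorphic (twist (twist_basePair bB)) (twist (twist_basePair bB')).
Proof.
move=> [a [b [S [T [c [chi [f [e Sa Tb co]]]]]]]].
move=> [a' [b' [S' [T' [c' [chi' [f' [e' Sa' Tb' co']]]]]]]].
move: e'; rewrite e => -[aa' bb']; subst a' b'.
have SS' : (S #= S')%card by apply: card_eq_trans Sa _; rewrite card_eq_sym.
have TT' : (T #= T')%card by apply: card_eq_trans Tb _; rewrite card_eq_sym.
have [phi [psi iso]] := coordinates_iso bB bB' co co' SS' TT'.
exact: (twist_twist_iso bB bB' (phi := phi) (psi := psi)).
Qed.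

(** Each code of a pair of cardinals receives a group realizing it, chosen if there is one;
    [coordinate_type_iso] makes the choice immaterial up to isomorphism. *)
Lemma countably_many_iso_singular (R : realType) :
  exists F : nat -> topologicalGroupType,
    forall G : topologicalGroupType,
      locally_compact [set: G] -> polish R G -> iso_singular G ->
      exists n, topgroup_isomorphic G (F n).
Proof.
have /choice[F FP] : forall n, exists F : topologicalGroupType,
    forall (B : basePair) (bB : boolean_group B), coordinate_type n B ->
    topgroup_isomorphic (twist (twist_basePair bB)) F.
  move=> n.
  have [[B [bB Bn]]|nB] := pselect (exists B : basePair, exists _ : boolean_group B,
      coordinate_type n B).
    by exists (twist (twist_basePair bB)) => B' bB' B'n; exact: coordinate_type_iso Bn.
  by exists sign_group => B bB Bn; exfalso; apply: nB; exists B, bB.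
exists F => G lcG pG [B [bB iso]].
have [S [T [c [chi [f co]]]]] := iso_singular_coordinates lcG pG iso.
have [a Sa] := cardinal_natP S; have [b Tb] := cardinal_natP T.
exists (pickle (a, b)); apply: (topgroup_isomorphic_trans iso); apply: FP.
by exists a, b, S, T, c, chi, f; split => //; rewrite pickleK.
Qed.

Theorem corollary3p15 (R : realType) :
  (forall G : topologicalGroupType,
     locally_compact [set: G] -> polish R G ->
     ((forall d : G -> G -> R,
         is_pseudometric d -> left_invariant d -> right_invariant d) <->
      (forall d : G -> G -> R,
         Metr_c R G d -> left_invariant d -> right_invariant d)) /\
     ((forall d : G -> G -> R,
         Metr_c R G d -> left_invariant d -> right_invariant d) <->
      (abelian_group G \/ iso_singular G)))
  /\
  (exists F : nat -> topologicalGroupType,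
     forall G : topologicalGroupType,
       locally_compact [set: G] -> polish R G -> ~ abelian_group G ->
       (forall d : G -> G -> R,
          is_pseudometric d -> left_invariant d -> right_invariant d) ->
       exists n : nat, topgroup_isomorphic G (F n)).
Proof.
have i_ii (G : topologicalGroupType) :
    (forall d : G -> G -> R,
      is_pseudometric d -> left_invariant d -> right_invariant d) ->
    forall d : G -> G -> R,
      Metr_c R G d -> left_invariant d -> right_invariant d.
  by move=> inv d [[dP _] _ _]; exact: inv.
have ii_iii (G : topologicalGroupType) :
    locally_compact [set: G] -> polish R G ->
    (forall d : G -> G -> R,
      Metr_c R G d -> left_invariant d -> right_invariant d) ->
    abelian_group G \/ iso_singular G.
  move=> lcG pG inv; apply: (conjugates_trivial_iso_singular pG).
  exact: Metr_c_conjugates_trivial lcG pG inv.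
have iii_i (G : topologicalGroupType) :
    abelian_group G \/ iso_singular G ->
    forall d : G -> G -> R,
      is_pseudometric d -> left_invariant d -> right_invariant d.
  move=> GA d; apply: conjugates_trivial_right_invariant.
  by case: GA => [ab x g|/iso_singular_conjugates //]; left; exact: ab.
split=> [G lcG pG|].
  split; split; [exact: i_ii| | exact: ii_iii |].
    by move=> /(ii_iii G lcG pG)/iii_i.
  by move=> /iii_i/i_ii.
have [F FP] := countably_many_iso_singular R.
exists F => G lcG pG nab /i_ii/(ii_iii G lcG pG)[//|].
exact: FP.
Qed.
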